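(* Let $k\geq 1$ be an integer. Then for all sufficiently large $n$ (depending on $k$), every graph $G\in{\rm SPEX}(n,H_{2k+2})$ is obtained from a complete bipartite graph with parts $L$ and $R$ (where $|L|+|R|=n$) by embedding into $L$ a graph that is $k$-regular or nearly $k$-regular and contains no $P_{2k+2}$ as a subgraph. Moreover, if $k\geq 2$ is even then $|L|=\lfloor n/2\rfloor$ or $|L|=\lceil n/2\rceil$, and if $k\geq 1$ is odd then $|L|=\frac{n}{2}$ if $n\equiv 0 \pmod 4$; $|L|=\frac{n-1}{2}$ if $n\equiv 1\pmod 4$; $|L|=\frac{n}{2}$ if $k=1$ and $n\equiv 2\pmod 4$; $|L|=\frac{n}{2}-1$ or $|L|=\frac{n}{2}+1$ if $k\geq 3$ and $n\equiv 2\pmod 4$; $|L|=\frac{n+1}{2}$ if $n\equiv 3\pmod 4$.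
   Context: All graphs are finite, simple and undirected. The spectral radius $\rho(G)$ of a graph $G$ is the largest eigenvalue of its adjacency matrix. $P_m$ denotes the path on $m$ vertices. For $\ell\geq 4$, the fan $H_\ell=K_1\vee P_\ell$ is obtained by joining a single new vertex to all vertices of $P_\ell$. For a graph $F$, ${\rm SPEX}(n,F)$ is the set of graphs of order $n$ that contain no subgraph isomorphic to $F$ and have maximum spectral radius among all such graphs. A graph is nearly $k$-regular if all its vertices have degree $k$ except one vertex which has degree $k-1$. *)

(* Defs.v *)
From HB Require Import structures.
From mathcomp Require Import all_boot all_order all_algebra.
From mathcomp Require Import reals.

Set Implicit Arguments.
Unset Strict Implicit.
Unset Printing Implicit Defensive.

Import Order.TTheory GRing.Theory Num.Theory.

Local Open Scope ring_scope.

Record sgraph (V : finType) := SGraph {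
  adj :> rel V;
  adj_sym : symmetric adj;
  adj_irr : irreflexive adj }.

Lemma complete_sym (V : finType) : symmetric (fun x y : V => x != y).
Proof. by move=> x y; rewrite eq_sym. Qed.

Lemma complete_irr (V : finType) : irreflexive (fun x y : V => x != y).
Proof. by move=> x; rewrite eqxx. Qed.

Definition complete_graph (m : nat) : sgraph 'I_m :=
  SGraph (@complete_sym 'I_m) (@complete_irr 'I_m).

Definition path_rel (m : nat) : rel 'I_m :=
  fun x y => (x.+1 == y :> nat) || (y.+1 == x :> nat).

Lemma path_sym m : symmetric (@path_rel m).
Proof. by move=> x y; rewrite /path_rel orbC. Qed.

Lemma path_irr m : irreflexive (@path_rel m).
Proof. by move=> x; rewrite /path_rel orbb eqn_leq ltnn. Qed.

Definition path_graph (m : nat) : sgraph 'I_m :=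
  SGraph (@path_sym m) (@path_irr m).

Definition join_rel (V W : finType) (G : sgraph V) (H : sgraph W) :
    rel (V + W)%type :=
  fun x y => match x, y with
    | inl u, inl v => G u v
    | inr u, inr v => H u v
    | _, _ => true
    end.

Lemma join_sym V W (G : sgraph V) (H : sgraph W) : symmetric (join_rel G H).
Proof. by case=> x [] y //=; apply: adj_sym. Qed.

Lemma join_irr V W (G : sgraph V) (H : sgraph W) : irreflexive (join_rel G H).
Proof. by case=> x /=; apply: adj_irr. Qed.

Definition join (V W : finType) (G : sgraph V) (H : sgraph W) :
    sgraph (V + W)%type :=
  SGraph (join_sym G H) (join_irr G H).

Definition fan (l : nat) : sgraph ('I_1 + 'I_l)%type :=
  join (complete_graph 1) (path_graph l).

(* Subgraphs are not required to be induced. *)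
Definition contains_subgraph (V W : finType) (G : sgraph V) (F : sgraph W) :
    Prop :=
  exists2 f : W -> V, injective f & forall x y, F x y -> G (f x) (f y).

Definition degree (V : finType) (G : sgraph V) (x : V) : nat :=
  #|[set y | G x y]|.

Definition regular (k : nat) (V : finType) (G : sgraph V) : Prop :=
  forall x, degree G x = k.

Definition nearly_regular (k : nat) (V : finType) (G : sgraph V) : Prop :=
  exists x, degree G x = k.-1 /\ forall y, y != x -> degree G y = k.

Definition adjacency_matrix (R : realType) (n : nat) (G : sgraph 'I_n) :
    'M[R]_n :=
  \matrix_(i, j) (G i j)%:R.

Definition is_spectral_radius (R : realType) (n : nat) (G : sgraph 'I_n)
    (r : R) : Prop :=
  eigenvalue (adjacency_matrix R G) r /\
  forall a : R, eigenvalue (adjacency_matrix R G) a -> a <= r.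

Definition SPEX (R : realType) (n : nat) (W : finType) (F : sgraph W)
    (G : sgraph 'I_n) : Prop :=
  ~ contains_subgraph G F /\
  exists r : R, is_spectral_radius G r /\
    forall (H : sgraph 'I_n) (s : R),
      ~ contains_subgraph H F -> is_spectral_radius H s -> s <= r.

Definition complete_bipartite_rel (V : finType) (L : {set V}) : rel V :=
  fun x y => (x \in L) (+) (y \in L).

Lemma complete_bipartite_sym (V : finType) (L : {set V}) :
  symmetric (complete_bipartite_rel L).
Proof. by move=> x y; rewrite /complete_bipartite_rel addbC. Qed.

Lemma complete_bipartite_irr (V : finType) (L : {set V}) :
  irreflexive (complete_bipartite_rel L).
Proof. by move=> x; rewrite /complete_bipartite_rel addbb. Qed.

(* The two parts are L and its complement. *)
Definition complete_bipartite (V : finType) (L : {set V}) : sgraph V :=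
  SGraph (complete_bipartite_sym L) (complete_bipartite_irr L).

Definition embed_rel (V : finType) (G : sgraph V) (L : {set V})
    (Q : sgraph {x : V | x \in L}) : rel V :=
  fun x y => G x y ||
    [exists u, exists v, [&& val u == x, val v == y & Q u v]].

Lemma embed_sym (V : finType) (G : sgraph V) (L : {set V})
  (Q : sgraph {x : V | x \in L}) : symmetric (embed_rel G Q).
Proof.
move=> x y; rewrite /embed_rel adj_sym; congr (_ || _).
by apply/existsP/existsP => -[u /existsP[v /and3P[ux vy quv]]];
  exists v; apply/existsP; exists u; rewrite ux vy adj_sym.
Qed.

Lemma embed_irr (V : finType) (G : sgraph V) (L : {set V})
  (Q : sgraph {x : V | x \in L}) : irreflexive (embed_rel G Q).
Proof.
move=> x; rewrite /embed_rel adj_irr /=; apply/existsP => -[u /existsP[v]].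
by case/and3P=> /eqP <- /eqP/val_inj ->; rewrite adj_irr.
Qed.

(* G with the edges of Q, a graph on the vertex subset L, added. *)
Definition embed (V : finType) (G : sgraph V) (L : {set V})
    (Q : sgraph {x : V | x \in L}) : sgraph V :=
  SGraph (embed_sym G Q) (embed_irr G Q).

(* Main.v *)
(* Let x be the Perron vector of an extremal graph G, normalised to have
   maximum 1, attained at v0, and let r be its spectral radius. Comparison with
   graphs K_{s,n-s} plus a k-regular graph made of blocks of at most 2k+1
   vertices in the part of size s gives r^2 - k r >= s (n - s), hence r^2 - k r
   >= n^2/4 - 1. Since the neighbourhood B of v0 contains no long path, it
   spans O(n) edges, and r^2 = \sum_w d_B(w) x_w, with d_B(w) the number of
   neighbours of w in B, forces B and its complement to form an almost complete
   and almost balanced bipartite graph. Reattaching any vertex to the typical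
   vertices of the complement of B creates no fan, so all entries of x are
   close to 1 and all vertices are adjacent to nearly all of the opposite part.

   A fan can now be threaded through any vertex with more than k neighbours in
   its own part. If linearly many vertices of a part L have k inner neighbours,
   then the other part has no edge at all and maximality makes the join
   complete; otherwise there are too few inner edges, the case k = 2 with two
   matchings being excluded by a second order comparison.

   Finally, if y is the value of x on the part opposite to L, then
     (r^2 - k r - |L| (n - |L|)) y = - \sum_(v in L) (k - deg_L v) x_v,
   so the total deficiency is at most 1, and the sizes follow from the lower
   bounds on r^2 - k r and the parity of k |L|. *)

Require Import Defs.
From mathcomp Require Import all_boot all_order all_algebra.
From mathcomp Require Import reals.
From mathcomp Require boolp classical_sets topology normedtype derive.
From mathcomp Require Import zify ring lra.

Set Implicit Arguments.
Unset Strict Implicit.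
Unset Printing Implicit Defensive.

Import Order.TTheory GRing.Theory Num.Theory.

Local Open Scope ring_scope.

(** * Quadratic forms and the spectral radius *)

Module SphereMax.
Import boolp classical_sets topology normedtype derive.
Import numFieldNormedType.Exports.
Local Open Scope classical_set_scope.

Lemma continuous_sum (T : topologicalType) (R : realType) (I : Type)
    (s : seq I) (P : pred I) (f : I -> T -> R) :
  (forall i, continuous (f i)) ->
  continuous (fun u => \sum_(i <- s | P i) f i u).
Proof.
move=> fc; elim: s => [|i s IHs] u.
  under eq_fun do rewrite big_nil; exact: cst_continuous.
under eq_fun do rewrite big_cons.
case: (P i); last exact: IHs.
by apply: cvgD; [exact: fc | exact: IHs].
Qed.

Lemma continuous_sphere_max (R : realType) n (f : 'rV[R]_n.+1 -> R) :
  continuous f ->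
  exists2 c : 'rV[R]_n.+1, \sum_i c 0 i ^+ 2 = 1 &
    forall t : 'rV[R]_n.+1, \sum_i t 0 i ^+ 2 = 1 -> f t <= f c.
Proof.
move=> fc.
pose q := fun u : 'rV[R]_n.+1 => \sum_i u 0 i ^+ 2.
have qc : continuous q.
  apply: continuous_sum => i u; under eq_fun do rewrite expr2.
  have cc := @coord_continuous R 1 n.+1 0 i.
  exact: (cvgM (cc u) (cc u)).
pose K : set 'rV[R]_n.+1 := q @^-1` [set 1].
have Kcl : closed K by apply: preimage_closed; [by move=> u _;
  exact: qc | exact: closed_eq].
have Kb : bounded_set K.
  (* The norm of a row vector is its largest absolute entry, and each squared entry is at most the
     sum of squares. *)
  exists 1; split=> // M M1 v Kv; rewrite /Num.norm /= mx_normrE.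
  apply/bigmax_leP; split=> /= [|[i j] _]; first by apply/ltW/(lt_trans ltr01).
  apply: le_trans (ltW M1); rewrite ord1 -(@ler_pXn2r _ 2) ?nnegrE //.
  rewrite expr1n real_normK ?num_real //.
  have <- : q v = 1 by [].
  by rewrite /q (bigD1 j) //= lerDl sumr_ge0 // => l _; exact: sqr_ge0.
have Kcp := bounded_closed_compact Kb Kcl.
have K0 : K !=set0.
  exists (\row_i (i == ord0)%:R); rewrite /K /= /q (bigD1 ord0) //= mxE eqxx.
  rewrite big1 ?addr0 ?expr1n // => i /negbTE i0.
  by rewrite mxE i0 expr0n.
have [c cK cmax] := compact_EVT_max K0 Kcp (continuous_subspaceT fc).
by exists c => [|t tK]; [exact: set_mem cK | apply: cmax; exact: mem_set].
Qed.

Lemma continuous_bilinear_sum (R : realType) n (P : rel 'I_n) :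
  continuous (fun u : 'rV[R]_n => \sum_i u 0 i * \sum_(j | P i j) u 0 j).
Proof.
apply: continuous_sum => i u.
have cs : continuous (fun v : 'rV[R]_n => \sum_(j | P i j) v 0 j).
  by apply: continuous_sum => j v; exact: coord_continuous.
have cc := @coord_continuous R 1 n 0 i.
exact: (cvgM (cc u) (cs u)).
Qed.

End SphereMax.

(** The form y^T A y of the adjacency matrix A, so each edge counts twice. *)
Definition quad (R : realType) (V : finType) (G : sgraph V) (y : V -> R) : R :=
  \sum_v y v * \sum_(w | G v w) y w.

Definition perturb (R : realType) (V : finType) (x : V -> R) (v : V) (t : R) :
    V -> R :=
  fun w => if w == v then t else x w.

Section QuadraticForm.

Variables (R : realType) (V : finType).
Implicit Types (G : sgraph V) (x y : V -> R).

Lemma sum_perturb x v t (P : pred V) :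
  \sum_(w | P w && (w != v)) perturb x v t w = \sum_(w | P w && (w != v)) x w.
Proof. by apply: eq_bigr => w /andP[_ /negbTE wv]; rewrite /perturb wv. Qed.

Lemma sum_sqr_perturb x v t :
  \sum_w perturb x v t w ^+ 2 = t ^+ 2 + \sum_(w | w != v) x w ^+ 2.
Proof.
rewrite (bigD1 v) //= /perturb eqxx; congr (_ + _).
by apply: eq_bigr => w /negbTE ->.
Qed.

Lemma adjsum_split G y v :
  \sum_(w | G v w) y w = \sum_(w | w != v) (G v w)%:R * y w.
Proof.
rewrite big_mkcond /= [RHS]big_mkcond; apply: eq_bigr => w _.
by have [->|_] := eqVneq w v; rewrite ?adj_irr //=; case: (G v w);
  rewrite ?mul1r ?mul0r.
Qed.

(** There are no loops, hence no t^2 term: the form is affine in the entry at [v], with slope twice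
    the neighbour sum. *)
Lemma quad_perturb G x v t :
  quad G (perturb x v t) =
  2 * t * (\sum_(w | G v w) x w) +
  \sum_(u | u != v) x u * (\sum_(w | G u w && (w != v)) x w).
Proof.
have adjv : \sum_(w | G v w) perturb x v t w = \sum_(w | G v w) x w.
  apply: eq_bigr => w Gvw; rewrite /perturb; case: eqP => // wv.
  by rewrite wv adj_irr in Gvw.
rewrite /quad (bigD1 v) //= adjv {1}/perturb eqxx.
set S := \sum_(w | G v w) x w; set T := (X in _ = _ + X).
have -> : 2 * t * S + T = t * S + (t * S + T) by ring.
congr (_ + _); rewrite /S adjsum_split mulr_sumr -big_split /=.
apply: eq_bigr => u uv; rewrite {1}/perturb (negbTE uv).
rewrite (bigID (fun w => w != v)) /= sum_perturb mulrDr addrC; congr (_ + _).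
rewrite big_mkcond (bigD1 v) //= eqxx andbT /perturb eqxx adj_sym.
rewrite big1 ?addr0; last by move=> w /negbTE ->; rewrite andbF.
by case: (G v u) => /=; ring.
Qed.

Lemma quad_eigen G x mu :
  (forall v, \sum_(w | G v w) x w = mu * x v) ->
  quad G x = mu * \sum_v x v ^+ 2.
Proof.
by move=> e; rewrite mulr_sumr; apply: eq_bigr => v _; rewrite e expr2; ring.
Qed.

Lemma perturb_id x v : perturb x v (x v) =1 x.
Proof. by move=> w; rewrite /perturb; case: eqP => [->|]. Qed.

Lemma eq_quad G x y : x =1 y -> quad G x = quad G y.
Proof.
by move=> e; apply: eq_bigr => v _; rewrite e; congr (_ * _); apply: eq_bigr.
Qed.

(** The first-order condition at a maximiser, tested one coordinate at a time. *)
Lemma max_quad_eigen G x mu :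
  (forall y, quad G y <= mu * \sum_v y v ^+ 2) ->
  quad G x = mu * \sum_v x v ^+ 2 ->
  forall v, \sum_(w | G v w) x w = mu * x v.
Proof.
move=> ub ex v.
set S := \sum_(w | G v w) x w.
have main t : 2 * t * S <= mu * (2 * x v * t + t ^+ 2).
  have := ub (perturb x v (x v + t)).
  have := quad_perturb G x v (x v); rewrite (eq_quad _ (perturb_id x v)) ex.
  rewrite quad_perturb sum_sqr_perturb (bigD1 v) //= -/S.
  by set T := \sum_(u | _) _; set U := \sum_(u | _) _ => e1 e2; nra.
apply/eqP; rewrite -subr_eq0; set c := S - _.
have d0 : 0 < `|mu| + 1 by rewrite ltr_wpDl.
have hmu := ler_norm mu.
(* With this increment [main] becomes 2 d c^2 <= mu c^2, and 2 d > mu forces c = 0. *)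
have := main (c / (`|mu| + 1)); set d := `|mu| + 1 in d0 *.
have -> : S = c + mu * x v by rewrite /c; ring.
move=> h; have {}h : 2 * d * c ^+ 2 <= mu * c ^+ 2.
  rewrite -(ler_pM2r (_ : 0 < d ^- 2)) ?invr_gt0 ?exprn_gt0 //.
  have -> : 2 * d * c ^+ 2 / d ^+ 2 = 2 * (c / d) * c by field; lra.
  have -> : mu * c ^+ 2 / d ^+ 2 = mu * (c / d) ^+ 2 by field; lra.
  by move: h; lra.
have : c ^+ 2 <= 0 by rewrite /d in h d0; have := sqr_ge0 c; nra.
by rewrite -sqrf_eq0 eq_le sqr_ge0 andbT.
Qed.

End QuadraticForm.

Lemma eigenvalue_adjacencyP (R : realType) n (G : sgraph 'I_n) (a : R) :
  eigenvalue (adjacency_matrix R G) a <->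
  exists2 x : 'I_n -> R, (exists v, x v != 0) &
    forall v, \sum_(w | G v w) x w = a * x v.
Proof.
split=> [/eigenvalueP[x xA x0]|[x [v xv] xA]].
  exists (fun i => x 0 i).
    by case/rV0Pn: x0 => v xv; exists v.
  move=> v; have /rowP/(_ v) := xA; rewrite !mxE => <-.
  rewrite big_mkcond; apply: eq_bigr => w _; rewrite mxE (adj_sym G w v).
  by case: (G v w) => /=; rewrite ?mulr1 ?mulr0.
apply/eigenvalueP; exists (\row_i x i).
  apply/rowP => i; rewrite !mxE -xA [RHS]big_mkcond; apply: eq_bigr => w _.
  by rewrite !mxE (adj_sym G w i); case: (G i w) => /=; rewrite ?mulr1 ?mulr0.
by apply/rV0Pn; exists v; rewrite mxE.
Qed.

Lemma is_spectral_radius_quad_max (R : realType) n (G : sgraph 'I_n) (mu : R)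
    (x : 'I_n -> R) :
  (exists v, x v != 0) -> (forall v, \sum_(w | G v w) x w = mu * x v) ->
  (forall y, quad G y <= mu * \sum_v y v ^+ 2) -> is_spectral_radius G mu.
Proof.
move=> x0 ex ub; split; first by apply/eigenvalue_adjacencyP; exists x.
move=> a /eigenvalue_adjacencyP[y [v yv] ey].
have := ub y; rewrite (quad_eigen ey) ler_pM2r //.
rewrite (bigD1 v) //= ltr_pwDl ?exprn_even_gt0 //.
by apply: sumr_ge0 => i _; exact: sqr_ge0.
Qed.

(** A maximiser of the form on the unit sphere is an eigenvector; taking absolute values of its
    entries cannot decrease the form, which gives a nonnegative one. *)
Lemma spectral_radius_exists (R : realType) n (G : sgraph 'I_n) : (0 < n)%N ->
  exists mu : R, exists x : 'I_n -> R,
    [/\ is_spectral_radius G mu, forall v, 0 <= x v, exists v, 0 < x v,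
        forall v, \sum_(w | G v w) x w = mu * x v &
        forall y, quad G y <= mu * \sum_v y v ^+ 2].
Proof.
case: n G => // n G _.
have [c c1 cmax] :=
  SphereMax.continuous_sphere_max
    (@SphereMax.continuous_bilinear_sum R n.+1 (fun i j => G i j)).
set mu := (X in (forall t, _ -> _ <= X)) in cmax.
have ub y : quad G y <= mu * \sum_v y v ^+ 2.
  have [y0|y0] := eqVneq (\sum_v y v ^+ 2) 0.
    rewrite y0 mulr0 /quad big1 // => v _.
    have /eqP : y v ^+ 2 = 0.
      by apply/eqP; move/eqP: y0; rewrite psumr_eq0 => [/allP/(_ v)|i _];
        [apply; rewrite mem_index_enum | exact: sqr_ge0].
    by rewrite sqrf_eq0 => /eqP ->; rewrite mul0r.
  have s0 : 0 < \sum_v y v ^+ 2.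
    by rewrite lt_def y0 sumr_ge0 // => v _; exact: sqr_ge0.
  set s := \sum_v y v ^+ 2 in y0 s0 *.
  pose q := Num.sqrt s.
  have q0 : 0 < q by rewrite sqrtr_gt0.
  have q2 : q ^+ 2 = s by rewrite sqr_sqrtr // ltW.
  have := cmax (\row_i (y i / q)).
  have -> : \sum_i (\row_i (y i / q)) 0 i ^+ 2 = 1.
    under eq_bigr => i _ do rewrite mxE expr_div_n q2.
    by rewrite -mulr_suml divff.
  move=> /(_ erefl).
  have -> : quad G y = s * \sum_i (\row_i (y i / q)) 0 i *
      (\sum_(j | G i j) (\row_i (y i / q)) 0 j).
    rewrite mulr_sumr; apply: eq_bigr => i _; rewrite mxE.
    have -> : \sum_(j | G i j) (\row_i (y i / q)) 0 j =
        (\sum_(j | G i j) y j) / q.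
      by rewrite mulr_suml; apply: eq_bigr => j _; rewrite mxE.
    by rewrite -q2; field; lra.
  by rewrite [mu * s]mulrC ler_pM2l.
pose x i := `|c 0 i|.
have x1 : \sum_i x i ^+ 2 = 1.
  by rewrite -c1; apply: eq_bigr => i _; rewrite /x real_normK ?num_real.
have xq : quad G x = mu * \sum_i x i ^+ 2.
  apply/le_anti; rewrite ub x1 mulr1 /=.
  apply: ler_sum => i _; apply: le_trans (ler_norm _) _.
  by rewrite normrM ler_wpM2l //; exact: ler_norm_sum.
have xe := max_quad_eigen ub xq.
have xpos : exists v, 0 < x v.
  have [v xv|x0] := pickP (fun v => x v != 0).
    by exists v; rewrite lt_def xv /x normr_ge0.
  move: x1; rewrite big1 => [/eqP|i _]; first by rewrite eq_sym oner_eq0.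
  by have /negbFE/eqP -> := x0 i; rewrite expr0n.
exists mu, x; split=> //; last by move=> v; rewrite /x normr_ge0.
apply: is_spectral_radius_quad_max xe ub.
by have [v xv] := xpos; exists v; rewrite gt_eqF.
Qed.

(** * Finding paths and fans *)

Section Walks.

Local Open Scope nat_scope.

Lemma sorted_enum_succ l : sorted (fun i j : 'I_l => i.+1 == j :> nat) (enum
  'I_l).
Proof.
have := @sorted_map _ _ val (fun i j : nat => i.+1 == j) (enum 'I_l).
rewrite val_enum_ord => <-.
by case: l => // l /=; elim: l 0 => //= l IHl i; rewrite eqxx IHl.
Qed.

Lemma path_rel_succ m (i j : 'I_m) : i.+1 = j :> nat -> path_rel i j.
Proof. by move=> ij; rewrite /path_rel ij eqxx. Qed.

Variables (V : finType) (G : sgraph V).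
Implicit Types (p : seq V) (B T : {set V}).

Lemma tnth_path_adj p : sorted G p -> forall i j, path_rel i j ->
  G (tnth (in_tuple p) i) (tnth (in_tuple p) j).
Proof.
move=> sp i j; wlog {j} [x0 ij] : i j / V * (i.+1 == j :> nat) => [h|_].
  case/orP=> ij; last rewrite adj_sym.
    by apply: h; [split=> //;
      exact: (tnth (in_tuple p) i) | rewrite /path_rel ij].
  by apply: h; [split=> //;
    exact: (tnth (in_tuple p) i) | rewrite /path_rel ij].
rewrite !(tnth_nth x0) /= -(eqP ij).
by apply: (sortedP _ sp); rewrite (eqP ij).
Qed.

Lemma contains_pathP l :
  contains_subgraph G (path_graph l) <->
  exists p, [/\ uniq p, sorted G p & size p = l].
Proof.
split=> [[f fi fG]|[p [up sp <-]]].
  exists [seq f i | i <- enum 'I_l]; split.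
  - by rewrite map_inj_uniq ?enum_uniq.
  - rewrite sorted_map; apply: sub_sorted (sorted_enum_succ _).
    by move=> i j /eqP ij; exact: fG (path_rel_succ ij).
  - by rewrite size_map size_enum_ord.
by exists (tnth (in_tuple p)); [exact/tuple_uniqP | exact: tnth_path_adj].
Qed.

(** That the centre is off the path needs no separate clause: it is adjacent to every vertex of
    [p]. *)
Lemma contains_fanP l :
  contains_subgraph G (fan l) <->
  exists c p, [/\ uniq p, sorted G p, all (G c) p & size p = l].
Proof.
split=> [[f fi fG]|[c [p [up sp cp <-]]]].
  exists (f (inl ord0)), [seq f (inr i) | i <- enum 'I_l]; split.
  - by rewrite map_inj_uniq ?enum_uniq // => i j /fi [->].
  - rewrite sorted_map; apply: sub_sorted (sorted_enum_succ _).
    by move=> i j /eqP ij; exact: (fG (inr i) (inr j) (path_rel_succ ij)).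
  - by apply/allP => _ /mapP[i _ ->]; exact: fG.
  - by rewrite size_map size_enum_ord.
have hc i : G c (tnth (in_tuple p) i) by apply: (allP cp); exact: mem_tnth.
exists (fun z => if z is inr i then tnth (in_tuple p) i else c).
  move=> [i|i] [j|j] //= e; first by rewrite [i]ord1 [j]ord1.
  - by have := hc j; rewrite -e adj_irr.
  - by have := hc i; rewrite e adj_irr.
  - by congr inr; have /tuple_uniqP tI : uniq (in_tuple p) := up; exact: tI e.
move=> [i|i] [j|j] //=; first by rewrite [i]ord1 [j]ord1.
- by rewrite adj_sym.
- exact: tnth_path_adj.
Qed.

Lemma longer_fan l c p : uniq p -> sorted G p -> all (G c) p -> l <= size p ->
  contains_subgraph G (fan l).
Proof.
move=> up sp cp lp; apply/contains_fanP; exists c, (take l p); split.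
- exact: take_uniq.
- exact: take_sorted.
- by apply/allP => v /mem_take; apply/allP.
- by rewrite size_take_min; apply/minn_idPl.
Qed.

Definition nbr (v : V) : {set V} := [set w | G v w].

Lemma in_nbr v w : (w \in nbr v) = G v w.
Proof. by rewrite inE. Qed.

(** Greedy extension at the head of the path, whose neighbours in [B] outnumber the remaining
    vertices of the path. *)
Lemma min_degree_path B m : 0 < #|B| ->
  (forall v, v \in B -> m.-1 <= #|B :&: nbr v|) ->
  exists p, [/\ uniq p, sorted G p, all (mem B) p & size p = m].
Proof.
move=> B0 dB; elim: m dB => [|m IHm] dB; first by exists [::].
have [|[|z p] [up sp pB pm]] := IHm.
- by move=> v /dB; apply: leq_trans; exact: leq_pred.
- by have [v vB] := card_gt0P B0; exists [:: v]; rewrite /= vB -pm.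
have zB : z \in B by move: pB => /= /andP[].
have [u] : exists u, u \in (B :&: nbr z) :\: [set x in p].
  apply/card_gt0P; rewrite cardsD subn_gt0.
  apply: leq_trans (dB z zB); rewrite -pm /= ltnS.
  apply: leq_trans (card_size p); apply: subset_leq_card.
  by apply/subsetP => x; rewrite !inE => /andP[].
rewrite !inE => /and3P[up' uB zu]; exists (u :: z :: p); split=> //.
- rewrite cons_uniq up andbT inE negb_or up' andbT.
  by apply: contraTneq zu => ->; rewrite adj_irr.
- by rewrite /= adj_sym zu.
- by rewrite /= uB.
- by rewrite /= -pm.
Qed.

(** The degree of [v] is lost twice: as its own term, and spread over its neighbours. *)
Lemma sum_inner_degreeD1 B v : v \in B ->
  \sum_(u in B) #|B :&: nbr u| =
  \sum_(u in B :\ v) #|(B :\ v) :&: nbr u| + 2 * #|B :&: nbr v|.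
Proof.
move=> vB; rewrite (bigD1 v) //=.
have -> : \sum_(i in B | i != v) #|B :&: nbr i| =
    \sum_(i in B :\ v) (#|(B :\ v) :&: nbr i| + G v i).
  apply: eq_big => [i|i /andP[iB iv]]; first by rewrite !inE andbC.
  rewrite (cardsD1 v) inE vB in_nbr adj_sym /= addnC; congr (_ + _).
  by apply: eq_card => w; rewrite !inE andbA.
rewrite big_split /=.
have -> : \sum_(i in B :\ v) G v i = #|B :&: nbr v|.
  rewrite -sum1_card [RHS](eq_bigl (fun i => (i \in B :\ v) && G v i)).
    by rewrite -big_mkcondr; apply: eq_bigr => i _.
  by move=> i; rewrite !inE; case: eqP => //= ->; rewrite adj_irr andbF.
by rewrite mul2n -addnn addnCA.
Qed.

Lemma even_sum_inner_degree B : ~~ odd (\sum_(u in B) #|B :&: nbr u|).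
Proof.
have [n] := ubnP #|B|; elim: n B => // n IHn B Bn.
have [->|[v vB]] := set_0Vmem B; first by rewrite big_set0.
rewrite (sum_inner_degreeD1 vB) oddD oddM addbF; apply: IHn.
by rewrite (cardsD1 v) vB in Bn.
Qed.

(** By [min_degree_path] some vertex has inner degree below m - 1; deleting it lowers the sum by
    less than 2 m, and the rest is still path-free. *)
Lemma path_free_degree_sum B m :
  (forall p, uniq p -> sorted G p -> all (mem B) p -> size p = m -> False) ->
  \sum_(v in B) #|B :&: nbr v| <= 2 * m * #|B|.
Proof.
have [n] := ubnP #|B|; elim: n B => // n IHn B Bn noP.
have [->|[v0 v0B]] := set_0Vmem B; first by rewrite big_set0.
have B0 : 0 < #|B| by apply/card_gt0P; exists v0.
have [/forallP dB|] := boolP [forall v, (v \in B) ==> (m.-1 <= #|B :&: nbr v|)].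
  have [|p [up sp pB pm]] := @min_degree_path B m B0.
    by move=> v vB; exact: (implyP (dB v)).
  by case: (noP p).
rewrite negb_forall => /existsP[v]; rewrite negb_imply -ltnNge => /andP[vB dv].
rewrite (sum_inner_degreeD1 vB).
have : \sum_(i in B :\ v) #|(B :\ v) :&: nbr i| <= 2 * m * #|B :\ v|.
  apply: IHn => [|p up sp pB]; first by rewrite (cardsD1 v) vB in Bn.
  apply: noP up sp _.
  by apply: sub_all pB => i; rewrite !inE => /andP[].
by rewrite (cardsD1 v B) vB; nia.
Qed.

End Walks.

(** * Fans threaded between two vertex sets *)

Section FindingFans.

Local Open Scope nat_scope.

Variables (V : finType) (G : sgraph V).
Implicit Types (p : seq V) (B F T C : {set V}).

(** Segments alternate with single vertices, beginning and ending with a segment, so one more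
    segment than vertices is expected. *)
Fixpoint weave (vs : seq V) (ss : seq (seq V)) : seq V :=
  match vs, ss with
  | v :: vs', s :: ss' => s ++ v :: weave vs' ss'
  | [::], s :: _ => s
  | _, [::] => [::]
  end.

Lemma perm_weave vs ss : size ss = (size vs).+1 ->
  perm_eq (weave vs ss) (vs ++ flatten ss).
Proof.
elim: vs ss => [|v vs IHvs] [|s ss] //= [sz].
  by case: ss sz => //=; rewrite cats0.
rewrite -cat_cons perm_sym perm_catCA /= perm_cat2l perm_cons perm_sym.
exact: IHvs.
Qed.

(** The start [v0] is the vertex preceding the first segment, as the induction requires; [weave_fan]
    takes the centre for it. *)
Lemma weave_path v0 vs ss :
  size ss = (size vs).+1 ->
  all (fun s => (s != [::]) && sorted G s) ss ->
  {in v0 :: vs & flatten ss, forall v r, G v r} ->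
  path G v0 (weave vs ss).
Proof.
elim: vs v0 ss => [|v vs IHvs] v0 [|[|x s] ss] //=.
  move=> [/size0nil ->] /= /andP[xs _] adj.
  by rewrite xs adj ?andbT // !inE eqxx.
move=> [sz] /andP[xs ssP] adj.
rewrite cat_path xs /= adj ?inE ?eqxx //=.
rewrite adj_sym adj ?inE ?eqxx ?orbT //=; last first.
  by rewrite -in_cons -cat_cons mem_cat mem_last.
apply: IHvs => // y r yin rin; apply: adj; first by rewrite inE yin orbT.
by rewrite inE mem_cat rin !orbT.
Qed.

(** In the applications [vs] lies in the part of the centre or among its neighbours, and the
    segments lie opposite. The two are disjoint because they are completely adjacent and [G] has no
    loops. *)
Lemma weave_fan l c vs ss :
  size ss = (size vs).+1 ->
  all (fun s => (s != [::]) && sorted G s) ss ->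
  uniq vs -> uniq (flatten ss) -> all (G c) vs ->
  {in c :: vs & flatten ss, forall v r, G v r} ->
  l <= size vs + size (flatten ss) -> contains_subgraph G (fan l).
Proof.
move=> sz ssP uvs uss cvs adj ll; have pw := perm_weave sz.
apply: (@longer_fan _ _ _ c (weave vs ss)).
- rewrite (perm_uniq pw) cat_uniq uvs uss andbT /=; apply/hasPn => r rss.
  apply/negP => /= rvs; have := adj r r _ rss.
  by rewrite adj_irr inE rvs orbT => /(_ isT).
- by apply: path_sorted (weave_path sz ssP adj).
- rewrite (perm_all _ pw) all_cat cvs /=; apply/allP => r rss.
  by apply: adj => //; rewrite inE eqxx.
- by rewrite (perm_size pw) size_cat.
Qed.

Lemma uniq_list_of_card B j : j <= #|B| ->
  exists p, [/\ uniq p, size p = j & {subset p <= B}].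
Proof.
move=> jB; exists (take j (enum B)); split.
- by rewrite take_uniq ?enum_uniq.
- by rewrite size_take_min -cardE; apply/minn_idPl.
- by move=> v /mem_take; rewrite mem_enum.
Qed.

Lemma flatten_singletons p : flatten [seq [:: r] | r <- p] = p.
Proof. by elim: p => //= r p ->. Qed.

(** Alternating the t vertices of [T] with t + 1 vertices of [C] gives a path on 2 t + 1 vertices,
    all adjacent to [c]. *)
Lemma star_fan l c T C t : #|T| = t -> t < #|C| ->
  T \subset nbr G c -> {in c |: T, forall v, C \subset nbr G v} ->
  l <= t + t.+1 -> contains_subgraph G (fan l).
Proof.
move=> Tt tC Tc adj ll.
have [rs [urs srs rsC]] := uniq_list_of_card tC.
apply: (@weave_fan l c (enum T) [seq [:: r] | r <- rs]).
- by rewrite size_map srs -cardE Tt.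
- by apply/allP => _ /mapP[r _ ->].
- exact: enum_uniq.
- by rewrite flatten_singletons.
- by apply/allP => v; rewrite mem_enum => /(subsetP Tc); rewrite in_nbr.
- move=> v r; rewrite flatten_singletons inE mem_enum => vT /rsC rC.
  rewrite -in_nbr; apply: (subsetP (adj v _)) rC.
  by rewrite !inE.
- by rewrite flatten_singletons -cardE Tt srs.
Qed.

Definition missed B T : {set V} := \bigcup_(t in T) (B :\: nbr G t).

Lemma card_bigcup_le (I : finType) (P : pred I) (f : I -> {set V}) :
  #|\bigcup_(i | P i) f i| <= \sum_(i | P i) #|f i|.
Proof.
elim/big_rec2: _ => [|i n A _ le]; first by rewrite cards0.
by apply: leq_trans (leq_card_setU _ _).1 _; rewrite leq_add2l.
Qed.

Lemma card_missed B T h : {in T, forall t, #|B :\: nbr G t| <= h} ->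
  #|missed B T| <= #|T| * h.
Proof.
move=> th; apply: leq_trans (card_bigcup_le _ _) _.
by rewrite -sum_nat_const; apply: leq_sum.
Qed.

Lemma missedP B T v t : v \in B -> v \notin missed B T -> t \in T -> G t v.
Proof.
move=> vB /bigcupP vF tT; apply/negPn/negP => tv; case: vF.
by exists t => //; rewrite !inE tv.
Qed.

Definition degge B b : {set V} := [set v in B | b <= #|B :&: nbr G v|].

(** [F] and its neighbours in [B] are at most (k + 1) |F| vertices, so some [r] of inner degree at
    least b avoids them, and then the neighbours of [r] avoid [F]. The path is [r] with b of these;
    for b = 2 it has [r] in the middle, whence the bound on b. *)
Lemma exists_segment B F b k : b <= 2 ->
  {in B, forall v, #|B :&: nbr G v| <= k} -> F \subset B ->
  k.+1 * #|F| < #|degge B b| ->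
  exists s, [/\ uniq s, sorted G s, size s = b.+1 & {subset s <= B :\: F}].
Proof.
move=> b2 Bk FB big.
pose X := F :|: \bigcup_(f in F) (B :&: nbr G f).
have cX : #|X| <= k.+1 * #|F|.
  rewrite mulSn; apply: leq_trans (leq_card_setU _ _).1 _.
  rewrite leq_add2l; apply: leq_trans (card_bigcup_le _ _) _.
  by rewrite mulnC -sum_nat_const; apply: leq_sum => f /(subsetP FB)/Bk.
have [r] : exists r, r \in degge B b :\: X.
  apply/card_gt0P; rewrite cardsD subn_gt0; apply: leq_ltn_trans big.
  by apply: leq_trans cX; apply: subset_leq_card; rewrite subsetIr.
rewrite !inE negb_or => /andP[/andP[rF rX] /andP[rB br]].
have nF v : v \in B :&: nbr G r -> v \in B :\: F.
  rewrite !inE => /andP[vB rv]; rewrite vB andbT; apply: contra rX => vF.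
  by apply/bigcupP; exists v; rewrite // !inE rB adj_sym.
have [p [up sp pN]] := uniq_list_of_card br.
have rBF : r \in B :\: F by rewrite inE rF.
have rp v : v \in p -> G r v by move/pN; rewrite !inE => /andP[].
have pBF v : v \in p -> v \in B :\: F by move/pN/nF.
have rr v : v \in p -> v == r = false.
  by move/rp => rv; apply: contraTF rv => /eqP ->; rewrite adj_irr.
have sub q : all (mem (B :\: F)) q -> {subset q <= B :\: F} by move/allP.
case: b p b2 {br big} up sp {pN} rp pBF rr => [|[|[|//]]].
- by move=> p _ _ _ _ _ _; exists [:: r]; split=> //; apply: sub;
  rewrite /= rBF.
- case=> [|u [|]] // _ _ _ rp pBF rr; have uu := mem_head u [::].
  exists [:: r; u]; split=> //=; first by rewrite inE eq_sym rr.
    by rewrite rp.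
  by apply: sub; rewrite /= rBF pBF.
- case=> [|u [|w [|]]] // _ up _ rp pBF rr.
  have uu : u \in [:: u; w] by rewrite mem_head.
  have ww : w \in [:: u; w] by rewrite !inE eqxx orbT.
  exists [:: u; r; w]; split=> //=.
  + move: up; rewrite /= !inE negb_or (eq_sym r w) (rr u uu) (rr w ww) /=.
    by rewrite !andbT.
  + by rewrite adj_sym !rp.
  + by apply: sub; rewrite /= rBF !pBF.
Qed.

(** Greedy choice, the vertices already used being added to the forbidden set. *)
Lemma exists_segments B F b k j : b <= 2 ->
  {in B, forall v, #|B :&: nbr G v| <= k} -> F \subset B ->
  k.+1 * (#|F| + j * b.+1) < #|degge B b| ->
  exists ss, [/\ size ss = j,
    all (fun s => (size s == b.+1) && sorted G s) ss, uniq (flatten ss) &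
    {subset flatten ss <= B :\: F}].
Proof.
move=> b2 Bk FB; elim: j => [|j IHj] big; first by exists [::].
have [|ss [szs ssP uss ssF]] := IHj.
  by apply: leq_ltn_trans big;
    rewrite leq_mul2l leq_add2l leq_mul2r leqnSn orbT.
have fsz : size (flatten ss) = j * b.+1.
  rewrite -szs size_flatten /shape {szs uss ssF}; elim: ss ssP => //= s ss IH.
  by move=> /andP[/andP[/eqP -> _] /IH ->]; rewrite mulSn.
pose F' := F :|: [set v in flatten ss].
have [||s [us sG sz sF]] := @exists_segment B F' b k b2 Bk.
- by rewrite subUset FB; apply/subsetP => v; rewrite inE => /ssF; case/setDP.
- apply: leq_ltn_trans big; rewrite leq_mul2l /=.
  apply: leq_trans (leq_card_setU _ _).1 _; rewrite leq_add2l mulSn.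
  apply: leq_trans (leq_addl _ _); rewrite -fsz cardsE; exact: card_size.
exists (s :: ss); split.
- by rewrite /= szs.
- by rewrite /= sz eqxx sG.
- rewrite /= cat_uniq us uss andbT; apply/hasPn => v vss.
  by apply/negP => /sF; rewrite !inE vss orbT.
- move=> v; rewrite mem_cat => /orP[/sF|/ssF //].
  by rewrite !inE negb_or -andbA => /and3P[-> _ ->].
Qed.

(* A centre [c] with neighbours [T] inside its own part, interleaved with
   vertex-disjoint paths on [b + 1] vertices of the other part [B]. *)
Lemma segments_fan l c T B b k : b <= 2 ->
  {in B, forall v, #|B :&: nbr G v| <= k} -> T \subset nbr G c ->
  k.+1 * (#|missed B (c |: T)| + #|T|.+1 * b.+1) < #|degge B b| ->
  l <= #|T| + #|T|.+1 * b.+1 -> contains_subgraph G (fan l).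
Proof.
move=> b2 Bk Tc big ll.
have FB : missed B (c |: T) \subset B.
  by apply/bigcupsP => t _; exact: subsetDl.
have [ss [szs ssP uss ssF]] := exists_segments b2 Bk FB big.
have fsz : size (flatten ss) = #|T|.+1 * b.+1.
  rewrite -szs size_flatten /shape {szs uss ssF}; elim: ss ssP => //= s ss IH.
  by move=> /andP[/andP[/eqP -> _] /IH ->]; rewrite mulSn.
apply: (@weave_fan l c (enum T) ss) => //.
- by rewrite szs -cardE.
- by apply: sub_all ssP => -[|x s] /andP[].
- exact: enum_uniq.
- by apply/allP => v; rewrite mem_enum => /(subsetP Tc); rewrite in_nbr.
- move=> v r; rewrite inE mem_enum => vT /ssF /setDP[rB rF].
  by apply: missedP rB rF _; rewrite !inE.
- by rewrite -cardE fsz.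
Qed.

(** Using the edge [r1 r2] as one of the segments gains one vertex over pure alternation, so k inner
    neighbours of the centre suffice for a fan on a path of 2 k + 2 vertices. *)
Lemma edge_fan l c T B r1 r2 : r1 \in B -> r2 \in B -> G r1 r2 ->
  T \subset nbr G c -> r1 \notin missed B (c |: T) ->
  r2 \notin missed B (c |: T) ->
  #|missed B (c |: T)| + 2 + #|T| <= #|B| ->
  l <= #|T| + #|T|.+2 -> contains_subgraph G (fan l).
Proof.
move=> r1B r2B r12 Tc r1F r2F big ll.
have FB : missed B (c |: T) \subset B.
  by apply/bigcupsP => t _; exact: subsetDl.
pose C := B :\: (missed B (c |: T) :|: [set r1; r2]).
have [rs [urs srs rsC]] : exists p, [/\ uniq p,
  size p = #|T| & {subset p <= C}].
  apply: uniq_list_of_card; rewrite cardsD leq_subRL.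
    apply: leq_trans big; rewrite leq_add2r.
    apply: leq_trans (subset_leq_card (subsetIr _ _)) _.
    apply: leq_trans (leq_card_setU _ _).1 _; rewrite leq_add2l cards2.
    by case: eqP.
  exact/subset_leq_card/subsetIl.
have rsP r : r \in rs -> [/\ r \in B, r \notin missed B (c |: T),
  r != r1 & r != r2].
  move/rsC; rewrite in_setD in_setU in_set2 !negb_or.
  by case/andP=> /and3P[-> -> ->] ->.
apply: (@weave_fan l c (enum T) ([:: r1; r2] :: [seq [:: r] | r <- rs])).
- by rewrite /= size_map srs -cardE.
- by rewrite /= r12 /=; apply/allP => _ /mapP[r _ ->].
- exact: enum_uniq.
- rewrite /= flatten_singletons urs andbT !inE negb_or.
  rewrite -andbA; apply/and3P; split; last first.
  + by apply/negP => /rsP[_ _ _]; rewrite eqxx.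
  + by apply/negP => /rsP[_ _]; rewrite eqxx.
  + by apply: contraTneq r12 => ->; rewrite adj_irr.
- by apply/allP => v; rewrite mem_enum => /(subsetP Tc); rewrite in_nbr.
- move=> v r; rewrite inE mem_enum => vT;
  have {}vT : v \in c |: T by rewrite !inE.
  rewrite /= flatten_singletons !inE => /or3P[/eqP->|/eqP->|/rsP[rB rF _ _]].
  + exact: missedP r1B r1F vT.
  + exact: missedP r2B r2F vT.
  + exact: missedP rB rF vT.
- by rewrite /= flatten_singletons srs -cardE.
Qed.

End FindingFans.

(** * Fan-free graphs *)

Section Reattach.

Variables (V : finType) (G : sgraph V) (w : V) (S : {set V}).

Definition reattach_rel : rel V := fun u v =>
  if u == w then (v != w) && (v \in S)
  else if v == w then u \in S else G u v.

Lemma reattach_sym : symmetric reattach_rel.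
Proof.
move=> u v; rewrite /reattach_rel adj_sym.
by case: (eqVneq u w) => // _; case: (eqVneq v w).
Qed.

Lemma reattach_irr : irreflexive reattach_rel.
Proof. by move=> u; rewrite /reattach_rel adj_irr; case: eqP. Qed.

Definition reattach : sgraph V := SGraph reattach_sym reattach_irr.

Lemma reattachE u v : u != w -> v != w -> reattach u v = G u v.
Proof. by rewrite /reattach /= /reattach_rel => /negbTE-> /negbTE->. Qed.

Lemma reattachEl v : reattach w v = (v != w) && (v \in S).
Proof. by rewrite /reattach /= /reattach_rel eqxx. Qed.

(* A copy of [F] through [w] is rerouted through a vertex of [G] that is
   unused by the copy and adjacent to all the neighbours of [w] in it. *)
Lemma reattach_free (W : finType) (F : sgraph W) :
  ~ contains_subgraph G F ->
  (forall T U : {set V}, T \subset S -> (#|T| <= #|W|)%N -> (#|U| <= #|W|)%N ->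
     exists2 b, b \notin U & {in T, forall t, G t b}) ->
  ~ contains_subgraph reattach F.
Proof.
move=> GF rep [f fi fG].
have [/existsP[z0 /eqP z0w]|/existsPn fw] := boolP [exists z, f z == w];
  last first.
  by apply: GF; exists f => // x y /fG; rewrite reattachE.
have fzw z : z != z0 -> f z != w.
  by apply: contraNneq => fz; apply/eqP/fi; rewrite fz.
have zS z : F z0 z -> f z \in S.
  by move/fG; rewrite z0w reattachEl => /andP[].
have [|||b bU bT] :=
  rep [set f z | z in [pred z | F z0 z]] [set f z | z in predT].
- by apply/subsetP => _ /imsetP[z zF ->]; exact: zS.
- by apply: leq_trans (leq_imset_card _ _) (max_card _).
- by apply: leq_trans (leq_imset_card _ _) (max_card _).
have bf z : b != f z by apply: contraNneq bU => ->; exact: imset_f.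
apply: GF; exists (fun z => if z == z0 then b else f z).
  move=> x y; case: (eqVneq x z0) => [->|_]; case: (eqVneq y z0) => [->|_] //.
  - by move=> /eqP; rewrite (negbTE (bf y)).
  - by move=> /esym/eqP; rewrite (negbTE (bf x)).
  - exact: fi.
move=> x y; case: (eqVneq x z0) => [->|xz]; case: (eqVneq y z0) => [->|yz] Fxy.
- by rewrite adj_irr in Fxy.
- by rewrite adj_sym; apply: bT; exact: imset_f.
- by apply: bT; apply: imset_f; rewrite inE adj_sym.
- by have := fG x y Fxy; rewrite reattachE ?fzw.
Qed.

(** The test vector is x with its entry at [w] replaced by s / r, the best value for the new
    neighbourhood. Only terms at [w] change, and the comparison reduces to s^2 <= r^2 x_w^2. *)
Lemma reattach_eigen (R : realType) (x : V -> R) (r : R) :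
  0 < r -> (forall v, 0 <= x v) ->
  (forall v, \sum_(u | G v u) x u = r * x v) ->
  (forall y, quad reattach y <= r * \sum_v y v ^+ 2) ->
  \sum_(u in S | u != w) x u <= r * x w.
Proof.
move=> r0 x0 ex ub; set s := \sum_(u in S | _) x u.
have s0 : 0 <= s by exact: sumr_ge0.
have := ub (perturb x w (s / r)); rewrite quad_perturb sum_sqr_perturb.
have := quad_perturb G x w (x w); rewrite (eq_quad _ (perturb_id x w)).
rewrite (quad_eigen ex) (bigD1 w) //= ex.
have -> : \sum_(u | reattach w u) x u = s.
  by apply: eq_bigl => u; rewrite reattachEl andbC.
have -> : \sum_(u | u != w) x u * (\sum_(v | reattach u v && (v != w)) x v) =
    \sum_(u | u != w) x u * (\sum_(v | G u v && (v != w)) x v).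
  apply: eq_bigr => u uw; congr (_ * _); apply: eq_bigl => v.
  by case: (eqVneq v w) => [|vw]; rewrite ?andbF // reattachE.
set T := \sum_(u | _) _ * _; set Y := \sum_(u | _) _ => e1 e2.
have {e1 e2} : 2 * (s / r) * s <= r * (s / r) ^+ 2 + r * x w ^+ 2 by nra.
have -> : r * (s / r) ^+ 2 = s ^+ 2 / r by field; rewrite gt_eqF.
have -> : 2 * (s / r) * s = s ^+ 2 / r + s ^+ 2 / r by field; rewrite gt_eqF.
rewrite lerD2l ler_pdivrMr // => h.
rewrite -(@ler_pXn2r _ 2) ?nnegrE ?mulr_ge0 ?(ltW r0) //.
by apply: le_trans h _; rewrite exprMn; lra.
Qed.

End Reattach.

(** * Complete bipartite graphs with edges added in one part *)

Section BipJoin.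

Variables (V : finType) (L : {set V}) (Q : sgraph V).

(** [Q] lives on all of [V] and only its edges inside [L] count, which avoids the subset type of
    [embed]; in particular [Q] may be the extremal graph itself. *)
Definition bip_join_rel : rel V := fun u v =>
  (u \in L) (+) (v \in L) || [&& u \in L, v \in L & Q u v].

Lemma bip_join_sym : symmetric bip_join_rel.
Proof.
by move=> u v; rewrite /bip_join_rel addbC adj_sym; congr (_ || _);
  rewrite andbCA.
Qed.

Lemma bip_join_irr : irreflexive bip_join_rel.
Proof. by move=> u; rewrite /bip_join_rel addbb adj_irr !andbF. Qed.

Definition bip_join : sgraph V := SGraph bip_join_sym bip_join_irr.

Lemma bip_join_relE u v :
  bip_join_rel u v = if u \in L then (v \in L) ==> Q u v else v \in L.
Proof. by rewrite /bip_join_rel; do 2!case: (_ \in L). Qed.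

Lemma bip_joinE u v :
  bip_join u v = if u \in L then (v \in L) ==> Q u v else v \in L.
Proof. exact: bip_join_relE. Qed.

(** The complement of [L] is independent, so each consecutive pair of the path meets [L]. *)
Lemma count_alternating p m : sorted bip_join p -> size p = (2 * m)%N ->
  (m <= count (mem L) p)%N.
Proof.
elim: m p => [|m IHm] [|u [|v p]] //=; rewrite ?mulnS; try by move=> *; lia.
move=> /andP[uv /path_sorted pp] [sp].
have {IHm} := IHm p pp sp; rewrite bip_join_relE in uv.
by case: (u \in L) uv => //= [_|->]; lia.
Qed.

(** A centre in [L] would have at least k + 1 of the path vertices as neighbours in [L]; a centre
    outside [L] would have the whole path inside [L]. *)
Lemma bip_join_fan_free k :
  {in L, forall v, #|L :&: nbr Q v| <= k}%N ->
  (forall p, uniq p -> sorted Q p -> {subset p <= L} -> size p = (2 * k + 2)%N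
    ->
     False) ->
  ~ contains_subgraph bip_join (fan (2 * k + 2)).
Proof.
move=> Lk noP /contains_fanP[c [p [up sp cp szp]]].
have [cL|cL] := boolP (c \in L).
  have : (k < count (mem L) p)%N.
    by apply: count_alternating => //; rewrite szp mulnS addnC.
  apply/negP; rewrite -leqNgt -size_filter; apply: leq_trans (Lk c cL).
  rewrite cardE; apply: uniq_leq_size; first exact: filter_uniq.
  move=> v; rewrite mem_filter mem_enum !inE /= => /andP[vL /(allP cp)].
  by rewrite bip_joinE cL vL.
have pL : {subset p <= L}.
  by move=> v /(allP cp); rewrite bip_joinE (negbTE cL).
apply: (noP p) => //; apply: sub_in_sorted sp; last by apply/allP; exact: pL.
by move=> u v /= uL vL; rewrite bip_join_relE uL vL.
Qed.

Lemma sum_bip_join (R : realType) (y : V -> R) v :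
  \sum_(u | bip_join v u) y u =
  if v \in L then \sum_(u in ~: L) y u + \sum_(u in L | Q v u) y u
  else \sum_(u in L) y u.
Proof.
have [vL|vL] := boolP (v \in L); last first.
  by apply: eq_bigl => u; rewrite bip_joinE (negbTE vL).
rewrite (bigID (mem L)) /= addrC; congr (_ + _); apply: eq_bigl => u.
  by rewrite bip_join_relE vL inE; case: (u \in L); rewrite ?andbF.
by rewrite bip_join_relE vL; case: (u \in L); rewrite ?andbF // andbT.
Qed.

End BipJoin.

Lemma sum_in_setC (R : realType) (V : finType) (L : {set V}) (f : V -> R) :
  \sum_v f v = \sum_(v in L) f v + \sum_(v in ~: L) f v.
Proof.
by rewrite (bigID (mem L)) /=; congr (_ + _); apply: eq_bigl => v; rewrite inE.
Qed.

(** * Regular graphs without long paths *)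

Section CirculantGraph.

Local Open Scope nat_scope.

Variables t k : nat.

(* The [k] differences closest to [t / 2], leaving out [t / 2] itself when
   [t - k] is even. *)
Definition circ_step (j : nat) : bool :=
  [&& (t.+1 - k)./2 <= j, j <= t - (t.+1 - k)./2 & odd (t - k) || (j.*2 != t)].

Definition circ_rel (i j : nat) : bool := circ_step ((i - j) + (j - i)).

Lemma circ_step_sym j : j <= t -> circ_step (t - j) = circ_step j.
Proof. by rewrite /circ_step; lia. Qed.

Hypothesis kt : k < t.

Lemma circ_step0 : circ_step 0 = false.
Proof. by rewrite /circ_step; lia. Qed.

Lemma sum_nat_true (f : nat -> bool) m n :
  (forall j, m <= j < n -> f j) -> \sum_(m <= j < n) f j = n - m.
Proof.
move=> fT; rewrite -[RHS]muln1 -sum_nat_const_nat.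
by apply: eq_big_nat => j /fT ->.
Qed.

Lemma sum_nat_false (f : nat -> bool) m n :
  (forall j, m <= j < n -> ~~ f j) -> \sum_(m <= j < n) f j = 0.
Proof. by move=> fF; rewrite big_nat big1 // => j /fF /negbTE ->. Qed.

(** The interval from a to t - a has k elements when t - k is odd; otherwise it has k + 1 and its
    midpoint is left out. *)
Lemma sum_circ_step : 0 < k -> ~~ odd (k * t) -> \sum_(1 <= j < t) circ_step j
  = k.
Proof.
move=> k0; rewrite oddM negb_and => even_kt; set a := (t.+1 - k)./2.
have [a0 at' kE] : [/\ 0 < a, a.*2 <= t & k <= t] by rewrite /a; split; lia.
rewrite (big_cat_nat (n := a)) /=; [|lia|lia].
rewrite sum_nat_false ?add0n; last by rewrite /circ_step -/a; lia.
rewrite (big_cat_nat (n := (t - a).+1)) /=; [|lia|lia].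
rewrite [X in _ + X]sum_nat_false ?addn0; last by rewrite /circ_step -/a; lia.
have [tk|tk] := boolP (odd (t - k)).
  by rewrite sum_nat_true; [rewrite /a; lia|rewrite /circ_step -/a tk; lia].
(* Here t - k and k t are both even, so t is even and the midpoint exists. *)
have t2 : t = t./2.*2 by move: tk even_kt; rewrite oddB //; lia.
rewrite (big_cat_nat (n := t./2)) /=; [|lia|lia].
rewrite (big_cat_nat (m := t./2) (n := t./2.+1)) /=; [|lia|lia].
rewrite sum_nat_true; last by rewrite /circ_step -/a; lia.
rewrite sum_nat_false; last by rewrite /circ_step -/a; lia.
by rewrite sum_nat_true; [rewrite /a; lia|rewrite /circ_step -/a; lia].
Qed.

(** Indices below i give the differences 1 to i; those above i give, after the reflection of j to t
    - j, the differences i + 1 to t - 1. *)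
Lemma circ_degree i : 0 < k -> i < t -> ~~ odd (k * t) ->
  \sum_(0 <= j < t) circ_rel i j = k.
Proof.
move=> k0 it even_kt; rewrite -[RHS]sum_circ_step //.
rewrite (big_cat_nat (n := i)) /=; [|lia|lia].
rewrite [X in _ + X]big_ltn // {2}/circ_rel subnn circ_step0 add0n.
rewrite [RHS](big_cat_nat (n := i.+1)) /=; [|lia|lia].
congr (_ + _).
  rewrite big_nat_rev big_add1 /=; apply: eq_big_nat => j ji.
  by rewrite /circ_rel; congr (nat_of_bool (circ_step _)); lia.
rewrite big_nat_rev /=; apply: eq_big_nat => j ji.
rewrite -circ_step_sym; last lia.
by rewrite /circ_rel; congr (nat_of_bool (circ_step _)); lia.
Qed.

End CirculantGraph.

Section RegularBlocks.

Local Open Scope nat_scope.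

Variables (V : finType) (k : nat).

(** Vertices of [K] are numbered by their position in [enum K]. The guard [k < #|K|] keeps the
    difference 0 out, so that the relation is irreflexive for every [K]. *)
Definition circ_on_rel (K : {set V}) : rel V := fun u v =>
  [&& u \in K, v \in K &
   (k < #|K|) && circ_rel #|K| k (index u (enum K)) (index v (enum K))].

Lemma circ_on_sym K : symmetric (circ_on_rel K).
Proof. by move=> u v; rewrite /circ_on_rel /circ_rel andbCA addnC. Qed.

Lemma circ_on_irr K : irreflexive (circ_on_rel K).
Proof.
move=> u; rewrite /circ_on_rel /circ_rel subnn.
by case: (ltnP k #|K|) => kK; rewrite ?andbF //= circ_step0 ?andbF.
Qed.

Definition circ_on K : sgraph V := SGraph (@circ_on_sym K) (@circ_on_irr K).

Lemma circ_on_degree (K : {set V}) v : 0 < k -> k < #|K| -> ~~ odd (k * #|K|) ->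
  v \in K -> #|K :&: nbr (circ_on K) v| = k.
Proof.
move=> k0 kK even_kK vK.
have iK : index v (enum K) < #|K| by rewrite cardE index_mem mem_enum.
rewrite -[RHS](circ_degree kK k0 iK even_kK).
have -> : #|K :&: nbr (circ_on K) v| =
    \sum_(u in K) circ_rel #|K| k (index v (enum K)) (index u (enum K)).
  rewrite -sum1_card big_mkcond [RHS]big_mkcond; apply: eq_bigr => u _.
  by rewrite !inE /= /circ_on_rel vK kK; case: (u \in K) => //=; case: circ_rel.
rewrite -big_enum (big_nth v) -cardE; apply: eq_big_nat => i /andP[_ iK'].
by rewrite index_uniq ?enum_uniq // -cardE.
Qed.

Definition merge_rel (K : {set V}) (C Q : sgraph V) : rel V := fun u v =>
  if u \in K then (v \in K) && C u v else (v \notin K) && Q u v.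

Lemma merge_sym K C Q : symmetric (merge_rel K C Q).
Proof. by move=> u v; rewrite /merge_rel !(adj_sym _ v);
  do 2!case: (_ \in K). Qed.

Lemma merge_irr K C Q : irreflexive (merge_rel K C Q).
Proof. by move=> u; rewrite /merge_rel !adj_irr !andbF if_same. Qed.

Definition merge_graph K C Q : sgraph V :=
  SGraph (@merge_sym K C Q) (@merge_irr K C Q).

(** No edge joins [K] to its complement, so the first vertex of a path decides its side. *)
Lemma merge_graph_path K C Q v p : path (merge_graph K C Q) v p ->
  if v \in K then all (mem K) p && path C v p else all (predC (mem K)) p &&
    path Q v p.
Proof.
elim: p v => [|u p IHp] v /=; first by rewrite if_same.
rewrite {1}/merge_rel => /andP[vu /IHp].
case vK: (v \in K) vu => /= /andP[uK vu];
  first by rewrite uK vu => /andP[-> ->].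
by rewrite (negbTE uK) vu => /andP[-> ->].
Qed.

(* Disjoint blocks of size [k + 1], closed off by one block of size between
   [k + 1] and [2 k + 1]. *)
Lemma exists_regular_blocks (L : {set V}) :
  0 < k -> k < #|L| -> ~~ odd (k * #|L|) ->
  exists2 Q : sgraph V, {in L, forall v, #|L :&: nbr Q v| = k} &
    forall p, uniq p -> sorted Q p -> {subset p <= L} -> size p <= k.*2.+1.
Proof.
move=> k0; have [n] := ubnP #|L|; elim: n L => // n IHn L Ln kL even_kL.
have small (K : {set V}) p : uniq p -> {subset p <= K} -> size p <= #|K|.
  by move=> up pK; rewrite cardE; apply: uniq_leq_size => // v /pK;
    rewrite mem_enum.
have [L2|L2] := leqP #|L| k.*2.+1.
  exists (circ_on L) => [v vL|p up _ pL]; first exact: circ_on_degree.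
  exact: leq_trans (small L p up pL) L2.
have [q [uq szq qL]] := uniq_list_of_card (kL : k.+1 <= #|L|).
pose K := [set v in q].
have cK : #|K| = k.+1 by rewrite cardsE (card_uniqP uq).
have KL : K \subset L by apply/subsetP => v; rewrite inE => /qL.
have cLK : #|L :\: K| = #|L| - k.+1 by rewrite cardsD (setIidPr KL) cK.
(* More than k vertices remain because |L| >= 2 k + 2, and the parity condition survives because k
   (k + 1) is even. *)
have [||| Q QL Qp] := IHn (L :\: K); rewrite ?cLK; [lia|lia| |].
  by move: even_kL; rewrite !oddM oddB //=; case: (odd k); case: (odd #|L|).
have even_kK : ~~ odd (k * #|K|) by rewrite cK oddM /= andbN.
exists (merge_graph K (circ_on K) Q) => [v vL|].
  have [vK|vK] := boolP (v \in K).
    rewrite -[RHS](circ_on_degree k0 _ even_kK vK) ?cK //.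
    apply: eq_card => u; rewrite !in_setI !in_nbr /= /merge_rel vK.
    by case: (boolP (u \in K)) => [uK|]; rewrite ?andbF // (subsetP KL).
  rewrite -[RHS](QL v) ?in_setD ?vK ?vL //.
  apply: eq_card => u;
    rewrite !in_setI in_setD !in_nbr /= /merge_rel (negbTE vK).
  by rewrite -!andbA andbCA.
case=> [|v p] // up pP pL; have := merge_graph_path pP.
have [vK /andP[pK _]|vK /andP[pK pQ]] := boolP (v \in K).
  have : size (v :: p) <= #|K|.
    by apply: small => // u; rewrite inE => /orP[/eqP->|/(allP pK)].
  by rewrite cK; move/leq_trans; apply; lia.
apply: Qp => // u uvp; rewrite in_setD pL // andbT.
by move: uvp; rewrite inE => /orP[/eqP->|/(allP pK)].
Qed.

End RegularBlocks.

(** * Lower bounds for the extremal spectral radius *)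

Section LowerBounds.

Variables (R : realType) (V : finType) (k : nat) (r : R).

(** No fan-free graph on [V] has spectral radius above r, put in Rayleigh form so that any test
    vector can be inserted directly. *)
Definition fan_free_bound : Prop :=
  forall H : sgraph V, ~ contains_subgraph H (fan (2 * k + 2)) ->
  forall y, quad H y <= r * \sum_v y v ^+ 2.

Implicit Types (L : {set V}) (Q : sgraph V) (y : V -> R).

Lemma quad_bip_join L Q y :
  quad (bip_join L Q) y =
  \sum_(v in L) y v * (\sum_(u in L | Q v u) y u) +
  2 * (\sum_(v in L) y v) * (\sum_(v in ~: L) y v).
Proof.
rewrite /quad (sum_in_setC L).
rewrite (eq_bigr (fun v => y v * \sum_(u in ~: L) y u +
    y v * \sum_(u in L | Q v u) y u)); last first.
  by move=> v vL; rewrite sum_bip_join vL mulrDr.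
rewrite big_split /= -mulr_suml.
rewrite [X in _ + X](eq_bigr (fun v => y v * \sum_(u in L) y u)); last first.
  by move=> v; rewrite inE sum_bip_join => /negbTE ->.
by rewrite -mulr_suml; ring.
Qed.

Lemma sum_const (A : {set V}) (c : R) : \sum_(v in A) c = #|A|%:R * c.
Proof. by rewrite sumr_const mulr_natl. Qed.

Lemma card_setC_real L : #|~: L|%:R = #|V|%:R - #|L|%:R :> R.
Proof. by rewrite cardsCs setCK natrB // max_card. Qed.

Hypothesis bound : fan_free_bound.
Hypothesis k0 : (0 < k)%N.

Lemma block_join_fan_free L : (k < #|L|)%N -> ~~ odd (k * #|L|) ->
  exists2 Q : sgraph V, {in L, forall v, #|L :&: nbr Q v| = k} &
    ~ contains_subgraph (bip_join L Q) (fan (2 * k + 2)).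
Proof.
move=> kL ekL; have [Q QL Qp] := exists_regular_blocks k0 kL ekL.
exists Q => //; apply: bip_join_fan_free => [v vL|p up sp pL szp].
  by rewrite QL.
by have := Qp p up sp pL; rewrite szp; lia.
Qed.

Lemma regular_lower_bound L : 0 < r -> (k < #|L|)%N -> ~~ odd (k * #|L|) ->
  #|L|%:R * #|~: L|%:R <= r ^+ 2 - k%:R * r.
Proof.
move=> r0 kL ekL; have [Q QL Qfree] := block_join_fan_free kL ekL.
set s : R := #|L|%:R; set s' : R := #|~: L|%:R.
have s0 : 0 < s by rewrite ltr0n; lia.
(* This vector satisfies the eigenvalue equation for r at the vertices outside [L]; after division
   by s r the comparison is the claim. *)
pose y v : R := if v \in L then r else s.
have yL v : v \in L -> y v = r by rewrite /y => ->.
have yR v : v \in ~: L -> y v = s by rewrite /y inE => /negbTE ->.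
have := bound Qfree y; rewrite quad_bip_join (sum_in_setC L).
rewrite (eq_bigr (fun=> r * (k%:R * r))); last first.
  move=> v vL; rewrite yL //; congr (_ * _).
  rewrite (eq_bigr (fun=> r)); last by move=> u /andP[/yL].
  rewrite -[k in RHS](QL v vL) -sum_const; apply: eq_bigl => u.
  by rewrite in_setI in_nbr.
rewrite sum_const (eq_bigr _ yL) (eq_bigr _ yR) !sum_const.
rewrite (eq_bigr (fun=> r ^+ 2)) => [|v /yL -> //].
rewrite [X in _ <= _ * (_ + X)](eq_bigr (fun=> s ^+ 2)) => [|v /yR -> //].
rewrite !sum_const -/s -/s' => h.
have sr : 0 < s * r by exact: mulr_gt0.
rewrite -(ler_pM2l sr); lra.
Qed.

Lemma fan_free_bound_gt0 : (k < #|V|)%N -> 0 < r.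
Proof.
move=> kV; have [p [up szp _]] := @uniq_list_of_card V [set: V] k.+1
  (leq_trans kV (eq_leq (esym (cardsT V)))).
pose L := [set v in p].
have cL : #|L| = k.+1 by rewrite cardsE (card_uniqP up).
(* A single block on k + 1 vertices and the constant vector 1 already make the form positive. *)
have [||Q QL Qfree] := @block_join_fan_free L; first by rewrite cL.
  by rewrite cL oddM /= andbN.
have := bound Qfree (fun=> 1); rewrite quad_bip_join.
rewrite (eq_bigr (fun=> k%:R)); last first.
  move=> v vL; rewrite mul1r -[k in RHS](QL v vL) -[RHS]mulr1 -sum_const.
  by apply: eq_bigl => u; rewrite in_setI in_nbr.
rewrite !sum_const cL expr1n sumr_const => h.
have : 0 < k.+1%:R * k%:R :> R by rewrite -natrM ltr0n muln_gt0.
have : 0 <= 2 * (k.+1%:R * 1) * (#|~: L|%:R * 1) :> R.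
  by rewrite !mulr1 !mulr_ge0 ?ler0n.
move=> h1 h2; have h3 : 0 < r * (1 *+ #|V|).
  by apply: lt_le_trans h; apply: ltr_wpDr.
by move: h3; rewrite pmulr_lgt0 // ltr0n; lia.
Qed.

(** For k = 1 and odd |L| the comparison graph has in [L] a perfect matching of all vertices but
    one, [w]. *)
Lemma near_matching_lower_bound L : k = 1%N -> 1 < r -> odd #|L| ->
  (2 < #|L|)%N -> (0 < #|~: L|)%N ->
  #|L|%:R * #|~: L|%:R * r - #|~: L|%:R <= r ^+ 2 * (r - 1).
Proof.
move=> k1 r1 oL L3 R0.
have [w wL] : exists w, w \in L by apply/card_gt0P; lia.
pose K := L :\ w.
have cK : #|L| = #|K|.+1 by rewrite (cardsD1 w L) wL.
have [||Q QK Qp] := @exists_regular_blocks V k K k0; [rewrite k1;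
  lia|rewrite k1 mul1n; lia|].
have KL v : v \in K -> v \in L by rewrite inE => /andP[].
pose C := merge_graph K Q Q.
have wK : w \notin K by rewrite !inE eqxx.
have LnK v : v \in L -> v \notin K -> v = w.
  by rewrite !inE => ->; rewrite andbT negbK => /eqP.
have CK v : v \in K -> L :&: nbr C v = K :&: nbr Q v.
  move=> vK; apply/setP => u; rewrite !in_setI !in_nbr /= /merge_rel vK.
  by case: (boolP (u \in K)) => [/KL ->|]; rewrite ?andbF.
have Cw : L :&: nbr C w = set0.
  apply/setP => u; rewrite in_setI in_nbr in_set0 /= /merge_rel (negbTE wK).
  by apply/and3P => -[uL uK]; rewrite (LnK u uL uK) adj_irr.
have Cfree : ~ contains_subgraph (bip_join L C) (fan (2 * k + 2)).
  apply: bip_join_fan_free => [v vL|p up sp pL szp].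
    have [vK|/(LnK v vL) ->] := boolP (v \in K); first by rewrite CK // QK.
    by rewrite Cw cards0.
  case: p up sp pL szp => [|v p] up sp pL szp; first by rewrite k1 in szp.
  have := merge_graph_path sp;
    have [vK /andP[pK pQ]|vK /andP[pK pQ]] := boolP (v \in K).
    have := Qp (v :: p) up pQ; rewrite szp k1 => h; suff : false by [].
    by apply: h => u; rewrite inE => /orP[/eqP->|/(allP pK)].
  case: p up pK pL szp {sp pQ} => [|u p] up pK pL szp;
    first by rewrite k1 in szp.
  have vw : v = w by apply: LnK => //; apply: pL; rewrite mem_head.
  have uw : u = w.
    by apply: LnK; [apply: pL; rewrite !inE eqxx orbT | case/andP: pK].
  by move: up; rewrite vw uw /= inE eqxx.
set s : R := #|L|%:R; set s' : R := #|~: L|%:R.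
have s'0 : 0 < s' by rewrite ltr0n.
have sE : s = #|K|%:R + 1 by rewrite /s cK natr1.
(* Chosen to satisfy the eigenvalue equation for r at every vertex of [L], so that the comparison
   reduces to the equation at the vertices outside [L]. *)
pose y v : R := if v \in L then if v == w then s' * (r - 1) else s' * r
                else r * (r - 1).
have yK v : v \in K -> y v = s' * r.
  by rewrite /y inE => /andP[]; rewrite inE => /negbTE -> ->.
have yw : y w = s' * (r - 1) by rewrite /y wL eqxx.
have yR v : v \in ~: L -> y v = r * (r - 1) by rewrite /y inE => /negbTE ->.
have sumL (f : V -> R) : \sum_(v in L) f v = f w + \sum_(v in K) f v.
  rewrite (bigD1 w) //=; congr (_ + _); apply: eq_bigl => v.
  by rewrite !inE andbC.
have := bound Cfree y; rewrite quad_bip_join (sum_in_setC L) !sumL.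
rewrite [\sum_(u in L | C w u) y u]big1; last first.
  by move=> u uC; have := in_set0 u; rewrite -Cw in_setI in_nbr uC.
rewrite (eq_bigr (fun=> s' * r * (s' * r))); last first.
  move=> v vK; rewrite yK //; congr (_ * _).
  rewrite (eq_bigl (mem (K :&: nbr Q v))).
    rewrite (eq_bigr (fun=> s' * r)) => [|u /setIP[/yK]] //.
    by rewrite sum_const QK // k1 mul1r.
  by move=> u; rewrite -CK // inE in_setI in_nbr.
rewrite sum_const (eq_bigr _ yK) (eq_bigr _ yR) !sum_const.
rewrite (eq_bigr (fun=> (s' * r) ^+ 2)) => [|v /yK -> //].
rewrite [X in _ <= _ * (_ + X)](eq_bigr (fun=> (r * (r - 1)) ^+ 2)) => [|v /yR
  -> //].
rewrite !sum_const yw -/s' => h.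
have pos : 0 < s' * (r * (r - 1)) by rewrite !mulr_gt0 //; lra.
rewrite -(ler_pM2l pos) sE; lra.
Qed.

End LowerBounds.

(** * Stability *)

(** The vector is scaled to maximum 1. [perron_low] comes from comparison graphs with a part of even
    size within one of n / 2; parity costs at most 1. *)
Record perron_extremal (R : realType) (V : finType) (k : nat) (G : sgraph V)
    (r : R) (x : V -> R) : Prop := PerronExtremal {
  perron_free : ~ contains_subgraph G (fan (2 * k + 2));
  perron_bound : fan_free_bound V k r;
  perron_ge0 : forall v, 0 <= x v;
  perron_le1 : forall v, x v <= 1;
  perron_max : exists v, x v = 1;
  perron_eigen : forall v, \sum_(w | G v w) x w = r * x v;
  perron_low : #|V|%:R ^+ 2 / 4 - 1 <= r ^+ 2 - k%:R * r }.

Section Stability.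

Variables (R : realType) (V : finType) (k : nat) (G : sgraph V).
Variables (r : R) (x : V -> R).
Hypotheses (k0 : (0 < k)%N) (extr : perron_extremal k G r x).

Local Notation n := #|V|.
Local Notation N := (#|V|%:R : R).
Local Notation l := (2 * k + 2)%N.

Lemma sum_nbr v (y : V -> R) : \sum_(w | G v w) y w = \sum_(w in nbr G v) y w.
Proof. by apply: eq_bigl => w; rewrite in_nbr. Qed.

Lemma exchange_nbr (B : {set V}) (y : V -> R) :
  \sum_(u in B) \sum_(w | G u w) y w = \sum_w #|B :&: nbr G w|%:R * y w.
Proof.
rewrite (exchange_big_dep predT) //=; apply: eq_bigr => w _.
rewrite -sum_const; apply: eq_bigl => u; rewrite in_setI in_nbr.
by rewrite adj_sym.
Qed.

Lemma card_split_nbr (B : {set V}) v :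
  #|B| = (#|B :&: nbr G v| + #|B :\: nbr G v|)%N.
Proof. by rewrite cardsID. Qed.

Lemma perron_r_ge1 : (4 <= n)%N -> 1 <= r.
Proof.
case: extr => _ _ x0 _ [v xv] ex low n4.
have r0 : 0 <= r.
  by rewrite -[r]mulr1 -xv -ex sumr_ge0.
have : 4 <= N by rewrite ler_nat.
have k1 : 1 <= k%:R :> R by rewrite ler1n.
by rewrite leNgt; move=> N4; apply/negP => r1; nra.
Qed.

Lemma perron_r_low : (4 <= n)%N -> N ^+ 2 / 4 <= r ^+ 2.
Proof.
move=> n4; have := perron_r_ge1 n4; have := perron_low extr.
have : 1 <= k%:R :> R by rewrite ler1n.
by nra.
Qed.

(** The error scale h is a small fraction of n, yet h^2 exceeds the total defect C n; hence all
    exceptional sets below have order h. *)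
Variables (v0 : V) (h : nat).
Hypothesis xv0 : x v0 = 1.
Local Notation C := (2 * l)%N.
Hypothesis h_big : (4 * C + l + 2 <= h)%N.
Hypothesis h_sqr : (C * n <= h * h)%N.
Hypothesis h_small : (4 * (l + 5) * h <= n)%N.

Let B := nbr G v0.
Let A := ~: B.
Let a : R := #|A|%:R.
Let b : R := #|B|%:R.

Lemma n_ge4 : (4 <= n)%N. Proof. nia. Qed.

Lemma card_AB : (#|A| + #|B| = n)%N.
Proof. by rewrite addnC cardsC. Qed.

Lemma ab_N : a + b = N.
Proof. by rewrite -natrD card_AB. Qed.

(** A path on 2 k + 2 vertices inside [B] would form a fan with centre [v0]. *)
Lemma sum_degree_B : \sum_(w in B) #|B :&: nbr G w|%:R * x w <= (C * n)%:R.
Proof.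
apply: (@le_trans _ _ (\sum_(w in B) #|B :&: nbr G w|)%:R); last first.
  rewrite ler_nat; apply: leq_trans (_ : C * #|B| <= _)%N; last first.
    by rewrite leq_mul2l max_card orbT.
  apply: path_free_degree_sum => p up sp pB szp.
  apply: (perron_free extr); apply: (@longer_fan _ _ _ v0 p); rewrite ?szp //.
  by apply/allP => u /(allP pB); rewrite /= in_nbr.
rewrite natr_sum; apply: ler_sum => w _.
by rewrite -[leRHS]mulr1 ler_wpM2l // (perron_le1 extr).
Qed.

(** The eigenvalue equation applied twice from [v0], where x is 1, gives r^2 as the sum of d_B(w)
    x_w over all w. *)
Lemma sum_defect_A :
  \sum_(w in A) (b - #|B :&: nbr G w|%:R * x w) = a * b - r ^+ 2 +
    \sum_(w in B) #|B :&: nbr G w|%:R * x w.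
Proof.
have r2 : r ^+ 2 = \sum_w #|B :&: nbr G w|%:R * x w.
  rewrite -exchange_nbr (eq_bigr _ (fun v _ => perron_eigen extr v)).
  by rewrite -mulr_sumr -sum_nbr (perron_eigen extr) xv0 mulr1 expr2.
rewrite sumrB sum_const r2 (sum_in_setC B) -/a -/A.
by ring.
Qed.

Lemma sum_defect_A_le :
  \sum_(w in A) (b - #|B :&: nbr G w|%:R * x w) <= (C * n)%:R.
Proof.
rewrite sum_defect_A; have := sum_degree_B; have := perron_r_low n_ge4.
by rewrite -ab_N; have := sqr_ge0 (a - b); nra.
Qed.

Lemma defect_A_ge0 w : 0 <= b - #|B :&: nbr G w|%:R * x w.
Proof.
rewrite subr_ge0; apply: (@le_trans _ _ #|B :&: nbr G w|%:R).
  by rewrite -[leRHS]mulr1 ler_wpM2l // (perron_le1 extr).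
by rewrite ler_nat subset_leq_card // subsetIl.
Qed.

Let H : R := h%:R.

Lemma Cn_le_hh : (C * n)%:R <= H ^+ 2.
Proof. by rewrite expr2 -natrM ler_nat. Qed.

(** The defects in [A] are nonnegative, so r^2 - a b <= C n, while r^2 >= (a + b)^2 / 4; hence (a -
    b)^2 <= 4 C n <= (2 h)^2. *)
Lemma balanced : `|a - b| <= 2 * H.
Proof.
have ab0 : 0 <= \sum_(w in A) (b - #|B :&: nbr G w|%:R * x w).
  by apply: sumr_ge0 => w _; exact: defect_A_ge0.
have H0 : 0 <= H by rewrite ler0n.
rewrite -(@ler_pXn2r _ 2) ?nnegrE ?mulr_ge0 // real_normK ?num_real //.
have := sum_degree_B; have := perron_r_low n_ge4; have := Cn_le_hh.
by move: ab0; rewrite sum_defect_A -ab_N; nra.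
Qed.

Lemma card_A_bounds : (2 * #|A| <= n + 2 * h)%N /\ (2 * #|B| <= n + 2 * h)%N.
Proof.
have := balanced; rewrite ler_norml => /andP[h1 h2]; have e := ab_N.
by split; rewrite -(ler_nat R) natrD !natrM -/a -/b -/H; lra.
Qed.

(** r^2 <= a b + C N <= (N / 2 + C)^2, and C <= h. *)
Lemma perron_r_high : r <= N / 2 + H.
Proof.
have ab0 : 0 <= \sum_(w in A) (b - #|B :&: nbr G w|%:R * x w).
  by apply: sumr_ge0 => w _; exact: defect_A_ge0.
have C0 : 0 <= (C%:R : R) by [].
have CH : C%:R <= H by rewrite ler_nat; lia.
have N0 : 0 <= N by [].
apply: (@le_trans _ _ (N / 2 + C%:R)); last by rewrite lerD2l.
have r1 := perron_r_ge1 n_ge4.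
rewrite -(@ler_pXn2r _ 2) ?nnegrE //; [|lra|lra].
have := sum_degree_B; have := sqr_ge0 (a - b).
by move: ab0; rewrite sum_defect_A -ab_N natrM -ab_N; nra.
Qed.

(** The defect of w is at least b (1 - x_w) and b >= N / 4, so the sum is at most 4 C. *)
Lemma sum_one_minus_A : \sum_(w in A) (1 - x w) <= H.
Proof.
have b4 : N / 4 <= b.
  have := card_A_bounds.1; have := card_AB; move=> e1 e2.
  have : (n <= 4 * #|B|)%N by nia.
  by rewrite -(ler_nat R) natrM -/b; lra.
have N0 : 0 < N by rewrite ltr0n; have := n_ge4; lia.
have b0 : 0 < b by lra.
rewrite -(ler_pM2l b0) mulr_sumr.
apply: (@le_trans _ _ (C * n)%:R).
  apply: le_trans sum_defect_A_le; apply: ler_sum => w _.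
  rewrite mulrBr mulr1 lerD2l lerN2 ler_wpM2r ?(perron_ge0 extr) //.
  by rewrite ler_nat subset_leq_card // subsetIl.
have : 4 * C%:R <= H by rewrite -natrM ler_nat; lia.
by rewrite natrM; have := ler0n R C; nra.
Qed.

Lemma sum_missing_A : (\sum_(w in A) #|B :\: nbr G w| <= C * n)%N.
Proof.
rewrite -(ler_nat R) natr_sum; apply: le_trans sum_defect_A_le.
apply: ler_sum => w _; rewrite /b (card_split_nbr B w) natrD.
have := ler0n R #|B :&: nbr G w|; have := perron_le1 extr w; nra.
Qed.

Lemma sum_missing_B : (\sum_(u in B) #|A :\: nbr G u| <= C * n)%N.
Proof.
apply: leq_trans sum_missing_A; apply: eq_leq.
rewrite (eq_bigr (fun u => \sum_(w in A | ~~ G u w) 1)%N); last first.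
  by move=> u _; rewrite -sum1_card; apply: eq_bigl => w; rewrite !inE andbC.
rewrite (exchange_big_dep (mem A)) /=; last by move=> u w _ /andP[].
apply: eq_bigr => w wA; rewrite -sum1_card; apply: eq_bigl => u.
by rewrite wA in_setD in_nbr adj_sym andbC.
Qed.

Definition typical (X Y : {set V}) : {set V} :=
  [set w in X | #|Y :\: nbr G w| <= h]%N.

(** Markov's inequality: each atypical vertex misses more than h vertices, and C n <= h^2. *)
Lemma card_atypical (X Y : {set V}) :
  (\sum_(w in X) #|Y :\: nbr G w| <= C * n)%N ->
  (#|X :\: typical X Y| <= h)%N.
Proof.
move=> sm; have hh : (#|X :\: typical X Y| * h.+1 <= C * n)%N.
  apply: leq_trans sm; rewrite -sum_nat_const.
  rewrite [leqRHS](big_setID (typical X Y)) /=.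
  apply: leq_trans (leq_addl _ _); apply: leq_sum => w.
  by rewrite !inE => /andP[]; case: (w \in X) => //=; rewrite -ltnNge.
by rewrite leqNgt; apply/negP => hX; nia.
Qed.

Let A' := typical A B.
Let B' := typical B A.

Lemma sum_A'_low : N / 2 - 3 * H <= \sum_(w in A') x w.
Proof.
have A'A : A' \subset A by apply/subsetP => w; rewrite inE => /andP[].
have cA : (#|A| <= #|A'| + h)%N.
  have := card_atypical sum_missing_A; rewrite cardsD (setIidPr A'A) -/A'.
  by rewrite leq_subLR.
have : \sum_(w in A') (1 - x w) <= H.
  apply: le_trans sum_one_minus_A; rewrite [leRHS](big_setID A') /=.
  rewrite (setIidPr A'A) lerDl sumr_ge0 // => w _.
  by rewrite subr_ge0 (perron_le1 extr).
rewrite sumrB sum_const mulr1.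
have : a <= #|A'|%:R + H by rewrite -natrD ler_nat.
have := balanced; rewrite ler_norml => /andP[h1 h2]; have := ab_N.
by lra.
Qed.

(** Reattach [w] to the typical vertices of [A]. Any boundedly many of these have a common neighbour
    in [B] outside a prescribed small set, so no fan arises and [reattach_eigen] applies. *)
Lemma perron_entry_low w : N / 2 - 4 * H <= r * x w.
Proof.
have h1 : (1 : R) <= H by rewrite ler1n; lia.
have [_ bB] := card_A_bounds; have [aA _] := card_A_bounds; have cAB := card_AB.
have xw1 := perron_le1 extr w.
apply: (@le_trans _ _ (\sum_(u in A' | u != w) x u)).
  have := sum_A'_low; rewrite (bigID (pred1 w)) /=.
  have : \sum_(u in A' | u == w) x u <= 1.
    rewrite (eq_bigl (fun u => (u == w) && (w \in A'))); last first.
      by move=> u; case: eqP => [->|]; rewrite ?andbT ?andbF.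
    by rewrite big_mkcondr big_pred1_eq; case: ifP.
  by lra.
have r0 : 0 < r by have := perron_r_ge1 n_ge4; lra.
apply: (reattach_eigen r0 (perron_ge0 extr) (perron_eigen extr)).
apply: (perron_bound extr); apply: reattach_free (perron_free extr) _.
move=> T U TA'; rewrite card_sum !card_ord => Tl Ul.
have mT : (#|missed G B T| <= #|T| * h)%N.
  by apply: card_missed => t /(subsetP TA'); rewrite inE => /andP[].
have [u] : exists u, u \in B :\: (missed G B T :|: U).
  apply/card_gt0P; rewrite cardsD subn_gt0.
  apply: leq_ltn_trans (subset_leq_card (subsetIr _ _)) _.
  apply: leq_ltn_trans (leq_card_setU _ _).1 _.
  have : (#|T| * h <= (1 + l) * h)%N by rewrite leq_mul2r Tl orbT.
  by nia.
rewrite in_setD in_setU negb_or => /andP[/andP[um uU] uB]; exists u => // t.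
exact: missedP uB um.
Qed.

(** From N / 2 - 4 H <= r x_w <= (N / 2 + H) x_w. *)
Lemma perron_entry_near1 w : (1 - x w) * N <= 10 * H.
Proof.
have := perron_entry_low w; have := perron_r_high; have := perron_ge0 extr w.
have := perron_le1 extr w; have : 0 <= H by []; have := perron_r_ge1 n_ge4.
nra.
Qed.

Lemma degree_low w : (n <= 2 * #|nbr G w| + 8 * h)%N.
Proof.
rewrite -(ler_nat R) natrD !natrM -/H.
have : r * x w <= #|nbr G w|%:R.
  rewrite -(perron_eigen extr) sum_nbr -[leRHS]mulr1 -sum_const.
  by apply: ler_sum => u _; exact: perron_le1 extr u.
have := perron_entry_low w; lra.
Qed.

(** Otherwise k + 1 typical neighbours of [w] in [A] alternate with common neighbours in [B] of
    these and [w], a fan centred at [w]. *)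
Lemma not_both_large w :
  ~~ ((l * h <= #|A :&: nbr G w|) && (l * h <= #|B :&: nbr G w|))%N.
Proof.
apply/negP => /andP[hA hB].
have [p [up szp pA]] : exists p,
    [/\ uniq p, size p = k.+1 & {subset p <= A' :&: nbr G w}].
  apply: uniq_list_of_card.
  have : (#|A :&: nbr G w| <= #|A' :&: nbr G w| + #|A :\: A'|)%N.
    apply: leq_trans (leq_card_setU _ _).1; apply: subset_leq_card.
    apply/subsetP => u; rewrite in_setU in_setD !in_setI => /andP[-> ->].
    by rewrite !andbT orbN.
  have := card_atypical sum_missing_A; rewrite -/A'.
  nia.
pose T := [set u in p].
have cT : #|T| = k.+1 by rewrite cardsE (card_uniqP up).
have TP u : u \in T -> u \in A' /\ G w u.
  by rewrite inE => /pA; rewrite in_setI in_nbr => /andP.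
have mT : (#|missed G B T| <= #|T| * h)%N.
  by apply: card_missed => t /TP[]; rewrite inE => /andP[].
apply: (perron_free extr).
apply: (@star_fan _ _ l w T ((B :&: nbr G w) :\: missed G B T) k.+1) => //.
- have := cardsD (B :&: nbr G w) (missed G B T).
  have := subset_leq_card (subsetIr (B :&: nbr G w) (missed G B T)).
  by move: mT; rewrite cT; nia.
- by apply/subsetP => u /TP[_]; rewrite in_nbr.
- move=> v vT; apply/subsetP => u;
  rewrite in_setD in_setI (in_nbr G w) (in_nbr G v).
  case/and3P=> um uB wu; move: vT; rewrite in_setU1 => /orP[/eqP -> //|vT].
  exact: missedP uB um vT.
- by lia.
Qed.

Lemma card_nbr_split w :
  (#|nbr G w| = #|A :&: nbr G w| + #|B :&: nbr G w|)%N.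
Proof.
rewrite -(cardsID B (nbr G w)) addnC setIC; congr (_ + _)%N.
  by apply: eq_card => u; rewrite !inE andbC.
Qed.

(** [L] collects the vertices with few neighbours in [A]. It contains the typical vertices of [A]
    and none of those of [B], so it differs from [A] by at most 2 h vertices; the degree bound then
    makes every vertex see almost all of the other side. *)
Lemma stable_partition : exists L : {set V},
  [/\ {in L, forall w, #|~: L :\: nbr G w| <= (l + 6) * h}%N,
      {in ~: L, forall w, #|L :\: nbr G w| <= (l + 6) * h}%N,
      (2 * #|L| <= n + 4 * h)%N & (2 * #|~: L| <= n + 4 * h)%N].
Proof.
pose L := [set w | #|A :&: nbr G w| < l * h]%N.
have [aA bB] := card_A_bounds; have cAB := card_AB.
have A'L : A' \subset L.
  apply/subsetP => w; rewrite inE => /andP[_ mw]; rewrite inE ltnNge.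
  apply/negP => hA; have := not_both_large w; rewrite hA /= => /negP; apply.
  by have := card_split_nbr B w; nia.
have B'L : B' \subset ~: L.
  apply/subsetP => w; rewrite inE => /andP[_ mw]; rewrite !inE -leqNgt.
  by have := card_split_nbr A w; nia.
have cA' := card_atypical sum_missing_A;
  have cB' := card_atypical sum_missing_B.
have AL : (#|A :&: ~: L| <= h)%N.
  apply: leq_trans cA'; apply: subset_leq_card; rewrite -/A' setDE.
  by apply: setIS; rewrite setCS.
have BL : (#|B :&: L| <= h)%N.
  apply: leq_trans cB'; apply: subset_leq_card; rewrite -/B' setDE.
  by apply: setIS; rewrite subsetC.
have split_le (X Y Z : {set V}) : X \subset Y :|: Z -> (#|X| <= #|Y| + #|Z|)%N.
  by move/subset_leq_card/leq_trans; apply; exact: (leq_card_setU _ _).1.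
exists L; split.
- move=> w; rewrite inE => wL.
  have := degree_low w; rewrite card_nbr_split => dw.
  have /split_le : ~: L :\: nbr G w \subset (B :\: nbr G w) :|: (A :&: ~: L).
    apply/subsetP => u; rewrite !in_setU !in_setD in_setI => /andP[-> ->].
    by rewrite andbT /= in_setC orbN.
  have := card_split_nbr B w; nia.
- move=> w; rewrite !inE => wL.
  have := degree_low w; rewrite card_nbr_split => dw.
  have dB : (#|B :&: nbr G w| < l * h)%N.
    by rewrite ltnNge; apply: contra (not_both_large w) => ->;
      rewrite leqNgt wL.
  have /split_le : L :\: nbr G w \subset (A :\: nbr G w) :|: (B :&: L).
    apply/subsetP => u; rewrite !in_setU !in_setD in_setI => /andP[-> ->].
    by rewrite andbT /= in_setC orNb.
  have := card_split_nbr A w; nia.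
- have /split_le : L \subset A :|: (B :&: L).
    by apply/subsetP => u uL; rewrite in_setU in_setI uL andbT in_setC orNb.
  by nia.
- have /split_le : ~: L \subset B :|: (A :&: ~: L).
    by apply/subsetP => u uL; rewrite in_setU in_setI uL andbT in_setC orbN.
  by nia.
Qed.

End Stability.

Lemma stability (k M : nat) : (0 < k)%N -> (0 < M)%N ->
  exists n0 : nat, forall (R : realType) (V : finType) (G : sgraph V) (r : R)
    (x : V -> R), perron_extremal k G r x -> (n0 <= #|V|)%N ->
  exists (L : {set V}) (h : nat),
    [/\ (M * h <= #|V|)%N /\ (M <= h)%N,
        {in L, forall w, #|~: L :\: nbr G w| <= h}%N,
        {in ~: L, forall w, #|L :\: nbr G w| <= h}%N,
        (2 * #|L| <= #|V| + h)%N /\ (2 * #|~: L| <= #|V| + h)%N &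
        forall w, (1 - x w) * M%:R <= 1].
Proof.
move=> k0 M0; set l := (2 * k + 2)%N.
(* With h the integer part of n / M', this factor keeps 10 M h, (l + 6) M h and 4 (l + 5) h below n.
   The threshold on n makes h >= 4 l M', whence 2 l n <= h^2. *)
pose M' := (M * (4 * l + 24))%N.
exists (M' * (4 * l * M' + M))%N => R V G r x ex nV.
set n := #|V|; pose h := (n %/ M')%N.
have M'0 : (0 < M')%N by rewrite /M'; nia.
have hn : (M' * h <= n)%N by rewrite mulnC leq_trunc_div.
have hlow : (4 * l * M' + M <= h)%N by rewrite leq_divRL // mulnC.
have nh : (n < M' * h.+1)%N by rewrite mulnC ltn_ceil.
have [v0 xv0] := perron_max ex.
have M'l : (4 * l + 24 <= M')%N by rewrite /M'; nia.
have big : (4 * (2 * l) + l + 2 <= h)%N by nia.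
have sqr : (2 * l * n <= h * h)%N.
  have n2 : (n <= 2 * M' * h)%N.
    have h0 : (0 < h)%N by lia.
    by apply: leq_trans (ltnW nh) _;
      rewrite mulnS -mulnA mul2n -addnn leq_add2r leq_pmulr.
  apply: (@leq_trans (4 * l * M' * h)); last by rewrite leq_mul2r; lia.
  apply: (@leq_trans (2 * l * (2 * M' * h)));
    first by rewrite leq_mul2l n2 orbT.
  by apply: eq_leq; ring.
have small : (4 * (l + 5) * h <= n)%N.
  by apply: leq_trans hn; rewrite leq_mul2r; apply/orP; right; lia.
have [L [L1 L2 L3 L4]] := stable_partition k0 ex xv0 big sqr small.
have h0 : (0 < h)%N by lia.
exists L, ((l + 6) * h)%N; split => //.
- split; last by apply: (@leq_trans h); [lia | rewrite leq_pmull // addnS].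
  apply: leq_trans hn; rewrite mulnA leq_mul2r; apply/orP; right.
  by rewrite leq_mul2l; apply/orP; right; lia.
- have : (4 * h <= (l + 6) * h)%N by rewrite leq_mul2r; apply/orP; right; lia.
  by move: L3 L4; rewrite -/n; lia.
move=> w; have := perron_entry_near1 k0 ex xv0 big sqr small w.
have n0 : 0 < #|V|%:R :> R.
  by rewrite ltr0n -/n; apply: leq_trans hn; rewrite muln_gt0 M'0.
have : 10 * h%:R * M%:R <= #|V|%:R :> R.
  rewrite -!natrM ler_nat -/n; apply: leq_trans hn.
  rewrite mulnAC leq_mul2r mulnC leq_mul2l; apply/orP; right.
  by apply/orP; right; lia.
rewrite -/n => h1 h2; rewrite -(ler_pM2r n0) mul1r.
apply: le_trans h1; rewrite mulrAC ler_wpM2r //.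
Qed.

(** * Inner degrees *)

Lemma quadE (R : realType) (V : finType) (G : sgraph V) (y : V -> R) :
  quad G y = \sum_(p : V * V) (G p.1 p.2)%:R * (y p.1 * y p.2).
Proof.
rewrite /quad -(pair_bigA _ (fun u v => (G u v)%:R * (y u * y v))) /=.
apply: eq_bigr => u _; rewrite big_mkcond mulr_sumr; apply: eq_bigr => v _.
by case: (G u v); rewrite ?mul1r ?mul0r ?mulr0.
Qed.

(** With positive entries every added edge strictly increases the form. *)
Lemma quad_maximal_supergraph (R : realType) (V : finType) (G H : sgraph V)
    (y : V -> R) : (forall v, 0 < y v) -> subrel G H -> quad H y <= quad G y ->
  forall u v, H u v = G u v.
Proof.
move=> y0 GH le u v.
have t0 (p : V * V) : 0 <= ((H p.1 p.2)%:R - (G p.1 p.2)%:R) * (y p.1 * y p.2).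
  apply: mulr_ge0; last by rewrite mulr_ge0 ?ltW.
  by rewrite subr_ge0 ler_nat; case Gp: (G p.1 p.2) => //; rewrite (GH _ _ Gp).
have : \sum_(p : V * V) ((H p.1 p.2)%:R - (G p.1 p.2)%:R) * (y p.1 * y p.2) = 0.
  apply/le_anti; rewrite sumr_ge0 // andbT.
  rewrite (eq_bigr _ (fun p _ => mulrBl _ _ _)) sumrB -!quadE; lra.
move/psumr_eq0P => /(_ (fun p _ => t0 p) (u, v) isT)/eqP /=.
have yy : 0 < y u * y v by exact: mulr_gt0.
rewrite mulf_eq0 (gt_eqF yy) orbF subr_eq0 eqr_nat.
by case: (H u v); case: (G u v).
Qed.

(** Here s, s' are the part sizes, A and B bound the typical inner degrees, and X, Y are the sums of
    Perron entries over the parts. Up to lower order terms the two summed equations give K r s <= (A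
    + B) r s, against A + B <= K - 1. *)
Lemma degree_sum_arith (R : realFieldType)
    (A B K N H r s s' t X Y DL DR : R) :
  0 <= A -> 0 <= B -> 1 <= K -> A + B + 1 <= K -> 0 <= H -> 500 <= N ->
  1000 * (K * H) <= N -> 0 <= t -> 500 * t <= N ->
  s + s' = N -> 2 * s <= N + H -> 2 * s' <= N + H ->
  N / 2 <= r -> r <= N -> N ^+ 2 / 4 - 1 <= r ^+ 2 - K * r ->
  0 <= X -> 8 * (K + 1) * (s - X) <= s ->
  DL <= A * s + t -> DR <= B * s' + t ->
  r * X <= DL + s * Y -> r * Y <= DR + s' * X -> False.
Proof.
move=> A0 B0 K1 ABK H0 N500 KH t0 tN sN sH s'H rN rN' low X0 h3 dL dR h1 h2.
have r0 : 0 < r by clear -rN N500; lra.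
have HN : 1000 * H <= N by clear -KH K1 H0; nra.
have s0 : 2 / 5 * N <= s by clear -sN s'H HN N500; lra.
have sp : 0 < s by clear -s0 N500; lra.
(* Eliminates Y between the two summed equations, using s s' <= N^2 / 4. *)
have e1 : (K * r - 1) * X <= r * (A * s + t) + s * (B * s' + t).
  have ss' : s * s' <= N ^+ 2 / 4.
    by rewrite -sN; have := sqr_ge0 (s - s'); clear; lra.
  have m1 : r * (r * X) <= r * (A * s + t + s * Y).
    by apply: ler_wpM2l; [exact: ltW | clear -h1 dL; lra].
  have m2 : s * (r * Y) <= s * (B * s' + t + s' * X).
    by apply: ler_wpM2l; [exact: ltW | clear -h2 dR; lra].
  have m3 : (K * r - 1) * X <= (r ^+ 2 - s * s') * X.
    by apply: ler_wpM2r => //; clear -ss' low; lra.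
  by clear -m1 m2 m3; lra.
have e2 : t * (r + s) <= s * (r / 8).
  have m1 : t * (r + s) <= t * (2 * N).
    by apply: ler_wpM2l => //; clear -rN' sH HN N500; lra.
  have m2 : t * (2 * N) <= N / 500 * (2 * N).
    by apply: ler_wpM2r; [clear -N500; lra | clear -tN; lra].
  have m3 : N * 2 / 5 * (N / 16) <= s * (r / 8).
    by apply: ler_pM; [clear -N500; lra | clear -N500; lra | clear -s0;
      lra | clear -rN; lra].
  have N2 : 0 <= N * N by apply: mulr_ge0; clear -N500; lra.
  by clear -m1 m2 m3 N2; lra.
have e3 : s * (B * s') <= s * (B * r + r / 8).
  apply: ler_wpM2l; first exact: ltW.
  have m1 : B * s' <= B * (r + H / 2).
    by apply: ler_wpM2l => //; clear -s'H rN; lra.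
  have m2 : B * H <= K * H.
    by apply: ler_wpM2r => //; clear -ABK A0; lra.
  by clear -m1 m2 KH rN N500; lra.
have Kr : 0 <= K * r - 1 by clear -K1 rN N500; nra.
(* Replaces X by s; like the errors in [e2] and [e3] this costs at most s r / 8, and three eighths
   stay below the missing unit. *)
have e4 : (K * r - 1) * s <= (K * r - 1) * X + s * (r / 8).
  have M1 : 0 < 8 * (K + 1) by clear -K1; lra.
  rewrite -lerBlDl -mulrBr -(ler_pM2l M1).
  have m1 : (K * r - 1) * (8 * (K + 1) * (s - X)) <= (K * r - 1) * s.
    exact: ler_wpM2l.
  have m2 : 0 <= r * s by apply: mulr_ge0; exact: ltW.
  by clear -m1 m2 sp; lra.
have e5 : (K * r - 1) * s <= ((A + B) * r + 3 * r / 8) * s.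
  by clear -e1 e2 e3 e4; lra.
rewrite ler_pM2r // in e5.
have e6 : (A + B) * r <= (K - 1) * r.
  by apply: ler_wpM2r; [exact: ltW | clear -ABK; lra].
by clear -e5 e6 rN N500; lra.
Qed.

Section Structure.

Variables (R : realType) (V : finType) (k : nat) (G : sgraph V).
Variables (r : R) (x : V -> R) (h : nat).
Hypotheses (k0 : (0 < k)%N) (extr : perron_extremal k G r x).

Local Notation n := #|V|.
Local Notation N := (#|V|%:R : R).
Local Notation l := (2 * k + 2)%N.
Local Notation thr := (2 * (k.+1 * (k.+1 * h)))%N.

Hypothesis h_big : (10 * k.+1 <= h)%N.
Hypothesis h_small : (500 * (k.+1 * thr) <= n)%N.
Hypothesis x_near1 : forall w, (1 - x w) * (8 * k.+1)%:R <= 1.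

Definition stable (L : {set V}) : Prop :=
  [/\ {in L, forall w, #|~: L :\: nbr G w| <= h}%N,
      {in ~: L, forall w, #|L :\: nbr G w| <= h}%N,
      (2 * #|L| <= n + h)%N & (2 * #|~: L| <= n + h)%N].

Lemma stableC L : stable L -> stable (~: L).
Proof. by rewrite /stable setCK => -[]. Qed.

Lemma thr_h : (2 * (k.+1 * h) <= thr)%N.
Proof. by rewrite leq_mul2l /= leq_pmull. Qed.

Lemma n_big : (500 * thr <= n)%N.
Proof. by apply: leq_trans h_small; rewrite leq_mul2l /= leq_pmull. Qed.

Lemma card_part L : stable L -> (250 * thr <= #|L| + h)%N.
Proof. by case=> _ _ _; have := cardsC L; have := n_big; lia. Qed.

Lemma part_big L : stable L -> (200 * thr <= #|L|)%N.
Proof. by move/card_part; have := thr_h; nia. Qed.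

Lemma card_missed_part L c (T : {set V}) : stable L -> c \in L -> T \subset L ->
  (#|missed G (~: L) (c |: T)| <= #|T|.+1 * h)%N.
Proof.
move=> [Lm _ _ _] cL TL; apply: leq_trans (@card_missed _ G _ _ h _) _.
  by move=> t; rewrite in_setU1 => /orP[/eqP ->|/(subsetP TL)]; apply: Lm.
by rewrite leq_mul2r cardsU1 -addn1 addnC leq_add2l leq_b1 orbT.
Qed.

Lemma sub_inner_nbr L c a : (a <= #|L :&: nbr G c|)%N ->
  exists T : {set V}, [/\ #|T| = a, T \subset L & T \subset nbr G c].
Proof.
move=> /uniq_list_of_card[p [up szp pL]].
exists [set v in p]; split; first by rewrite cardsE (card_uniqP up).
  by apply/subsetP => v; rewrite inE => /pL /setIP[].
by apply/subsetP => v; rewrite inE => /pL /setIP[].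
Qed.

(** k + 1 inner neighbours of [c] alternate with common neighbours in the other part, giving a path
    on 2 k + 3 vertices. *)
Lemma inner_degree L : stable L -> {in L, forall c, #|L :&: nbr G c| <= k}%N.
Proof.
move=> st c cL; rewrite leqNgt; apply/negP => /sub_inner_nbr[T [cT TL Tc]].
have mT := card_missed_part st cL TL.
apply: (perron_free extr).
apply: (@star_fan _ _ l c T (~: L :\: missed G (~: L) (c |: T)) k.+1) => //.
- have := cardsD (~: L) (missed G (~: L) (c |: T)).
  have := subset_leq_card (subsetIr (~: L) (missed G (~: L) (c |: T))).
  have := part_big (stableC st); have := thr_h.
  by move: mT; rewrite cT mulSn; nia.
- move=> v vT; apply/subsetP => u; rewrite in_setD in_nbr => /andP[um uB].
  exact: missedP uB um vT.
- lia.
Qed.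

(** Interleaving a inner neighbours of [c] with a + 1 segments of b + 1 vertices from the other part
    must not reach 2 k + 2 vertices. *)
Lemma degree_trade L c a b : stable L -> c \in L ->
  (a <= #|L :&: nbr G c|)%N -> (b <= 2)%N -> (thr < #|degge G (~: L) b|)%N ->
  (a + a.+1 * b.+1 <= 2 * k + 1)%N.
Proof.
move=> st cL ac b2 big; rewrite leqNgt; apply/negP => lab.
have ak : (a <= k)%N := leq_trans ac (inner_degree st cL).
have [T [cT TL Tc]] := sub_inner_nbr ac.
have mT := card_missed_part st cL TL.
apply: (perron_free extr).
apply: (@segments_fan _ _ l c T (~: L) b k) => //.
- exact: inner_degree (stableC st).
(* Half of [thr] pays for the vertices missed by [c |: T], the other half for the segments. *)
- apply: leq_ltn_trans big; rewrite [leqRHS]mulnCA leq_mul2l /=.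
  apply: (@leq_trans (k.+1 * h + k.+1 * h)); last by rewrite mul2n addnn.
  rewrite cT in mT *; apply: leq_add; first by apply: leq_trans mT _;
    rewrite leq_mul2r ltnS ak orbT.
  by apply: leq_mul; lia.
- by rewrite cT; clear -lab; lia.
Qed.

(** Among many vertices of inner degree k, one is adjacent together with all its inner neighbours to
    both ends of the edge, and [edge_fan] applies. *)
Lemma no_opposite_edge L : stable L -> (thr < #|degge G L k|)%N ->
  {in ~: L &, forall r1 r2, ~~ G r1 r2}.
Proof.
move=> st big r1 r2 r1R r2R; apply/negP => r12.
have [Lm Rm _ _] := st.
pose F := missed G L [set r1; r2].
have cF : (#|F| <= 2 * h)%N.
  apply: leq_trans (@card_missed _ G _ _ h _) _.
    by move=> t; rewrite in_set2 => /orP[]/eqP->; apply: Rm.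
  by rewrite leq_mul2r cards2; case: (r1 != r2); rewrite orbT.
(* To be avoided by the centre: non-neighbours of [r1] or [r2], and the inner neighbours of such
   vertices. *)
pose X := F :|: \bigcup_(f in F) (L :&: nbr G f).
have FL : F \subset L by apply/bigcupsP => t _; exact: subsetDl.
have cX : (#|X| <= k.+1 * (2 * h))%N.
  apply: (@leq_trans (k.+1 * #|F|)); last by rewrite leq_mul2l cF.
  rewrite mulSn; apply: leq_trans (leq_card_setU _ _).1 _.
  rewrite leq_add2l; apply: leq_trans (card_bigcup_le _ _) _.
  rewrite mulnC -sum_nat_const.
  by apply: leq_sum => f /(subsetP FL)/(inner_degree st).
have [c] : exists c, c \in degge G L k :\: X.
  apply/card_gt0P; rewrite cardsD subn_gt0; apply: leq_ltn_trans big.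
  apply: leq_trans (subset_leq_card (subsetIr _ _)) _.
  by apply: leq_trans cX _; have := thr_h; nia.
rewrite in_setD in_setU negb_or => /andP[/andP[cF' cX']].
rewrite inE => /andP[cL ck].
have [T [cT TL Tc]] := sub_inner_nbr ck.
have mT := card_missed_part st cL TL.
have adjr t ri : t \in c |: T -> ri \in [set r1; r2] -> G t ri.
  move=> tT ri12; rewrite adj_sym.
  have tL : t \in L by move: tT;
    rewrite in_setU1 => /orP[/eqP -> //|/(subsetP TL)].
  suff tm : t \notin F by exact: missedP tL tm ri12.
  move: tT; rewrite in_setU1 => /orP[/eqP -> //|tT].
  apply: contra cX' => tF; apply/bigcupP; exists t; first exact: tF.
  by rewrite in_setI cL in_nbr adj_sym -in_nbr (subsetP Tc).
have notm ri : ri \in [set r1; r2] -> ri \notin missed G (~: L) (c |: T).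
  move=> ri12; apply/negP => /bigcupP[t tT]; rewrite in_setD in_nbr.
  by rewrite adjr.
apply: (perron_free extr).
apply: (@edge_fan _ _ l c T (~: L) r1 r2) => //.
- by apply: notm; rewrite in_set2 eqxx.
- by apply: notm; rewrite in_set2 eqxx orbT.
- rewrite cT; have := part_big (stableC st); have := thr_h.
  by move: mT; rewrite cT mulSn; nia.
- by rewrite cT; clear; lia.
Qed.


Lemma entry_gt0 w : 0 < x w.
Proof.
have := x_near1 w; have : 8 <= (8 * k.+1)%:R :> R by rewrite ler_nat; lia.
by have := perron_ge0 extr w; nra.
Qed.

(** The vertices of the path have a common neighbour in the other part, which would be the centre of
    a fan. *)
Lemma part_path_free L p : stable L -> uniq p -> sorted G p -> {subset p <= L}
  ->
  size p = l -> False.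
Proof.
move=> st up sp pL szp; have [Lm _ _ _] := st.
have cm : (#|missed G (~: L) [set v in p]| <= l * h)%N.
  apply: leq_trans (@card_missed _ G _ _ h _) _.
    by move=> t; rewrite inE => /pL /Lm.
  by rewrite cardsE (card_uniqP up) szp.
have [c] : exists c, c \in ~: L :\: missed G (~: L) [set v in p].
  apply/card_gt0P; rewrite cardsD subn_gt0.
  apply: leq_ltn_trans (subset_leq_card (subsetIr _ _)) _.
  by have := part_big (stableC st); have := thr_h; nia.
rewrite in_setD => /andP[cm' cR]; apply: (perron_free extr).
apply: (@longer_fan _ _ l c p); rewrite ?szp //.
apply/allP => v vp; rewrite adj_sym; apply: missedP cR cm' _.
by rewrite inE.
Qed.

(** The join is a fan-free supergraph of [G], and the Perron entries are positive, so extremality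
    leaves no edge to add. *)
Lemma complete_join L : stable L -> (thr < #|degge G L k|)%N ->
  forall u v, G u v = bip_join L G u v.
Proof.
move=> st big u v; apply/esym.
apply: (@quad_maximal_supergraph R V G _ x entry_gt0).
  move=> {}u {}v uv; rewrite bip_joinE; case: ifPn => [_|uL].
    by rewrite uv implybT.
  apply/negPn/negP => vL.
  by have := no_opposite_edge st big; move=> /(_ u v);
    rewrite !inE uv => /(_ uL vL).
rewrite (quad_eigen (perron_eigen extr)); apply: (perron_bound extr).
apply: bip_join_fan_free => [|p up sp pL]; first exact: inner_degree st.
exact: part_path_free st up sp pL.
Qed.

(** The eigenvalue equation summed over [L], with the edges between the parts bounded as if all were
    present. *)
Lemma part_sum_le (L : {set V}) :
  r * (\sum_(w in L) x w) <=
  \sum_(w in L) #|L :&: nbr G w|%:R * x w + #|L|%:R * \sum_(w in ~: L) x w.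
Proof.
have -> : \sum_(w in L) #|L :&: nbr G w|%:R * x w =
    \sum_(w in L) \sum_(u in L | G w u) x u.
  rewrite (exchange_big_dep (mem L)) /=; last by move=> w u _ /andP[].
  apply: eq_bigr => u uL; rewrite -sum_const; apply: eq_bigl => w.
  by rewrite in_setI in_nbr uL adj_sym.
rewrite -sum_const -big_split mulr_sumr /=; apply: ler_sum => w wL.
rewrite -(perron_eigen extr) (bigID (mem L)) /=; apply: lerD.
  by rewrite le_eqVlt; apply/orP; left; apply/eqP/eq_bigl => u; rewrite andbC.
rewrite [leRHS](bigID (fun u => G w u)) /= -[leLHS]addr0; apply: lerD.
  rewrite le_eqVlt; apply/orP; left; apply/eqP/eq_bigl => u.
  by rewrite in_setC andbC.
by apply: sumr_ge0 => u _; exact: perron_ge0 extr u.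
Qed.

Lemma sum_inner_degree (L : {set V}) a : stable L -> (#|degge G L a.+1| <=
  thr)%N ->
  (\sum_(w in L) #|L :&: nbr G w| <= a * #|L| + k * thr)%N.
Proof.
move=> st small.
have le w : w \in L ->
    (#|L :&: nbr G w| <= a + k * (w \in degge G L a.+1))%N.
  move=> wL; rewrite inE wL /=; case: (leqP #|L :&: nbr G w| a) => [da|_];
    first lia.
  by have := inner_degree st wL; lia.
apply: leq_trans (leq_sum _ le) _;
  rewrite big_split /= sum_nat_const mulnC leq_add2l.
rewrite -big_distrr /= leq_mul2l; apply/orP; right; apply: leq_trans small.
rewrite -sum1_card [leqRHS](eq_bigl (fun w => (w \in L) && (w \in degge G L
  a.+1))).
  by rewrite big_mkcondr; apply: leq_sum => w _; case: (_ \in _).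
by move=> w; rewrite inE andbA andbb.
Qed.

Lemma degge_leq (L : {set V}) a b : (a <= b)%N -> (#|degge G L b| <= #|degge G
  L a|)%N.
Proof.
move=> ab; apply/subset_leq_card/subsetP => w; rewrite !inE => /andP[-> /=].
exact: leq_trans.
Qed.

(** a is the largest inner degree reached by more than [thr] vertices. *)
Lemma top_degree L : stable L -> (#|degge G L k| <= thr)%N ->
  exists a, [/\ (a < k)%N,
    (thr < #|degge G L a|)%N & (#|degge G L a.+1| <= thr)%N].
Proof.
move=> st small.
have ex0 : exists a, (thr < #|degge G L a|)%N.
  exists 0%N; have -> : degge G L 0 = L by apply/setP => w; rewrite !inE andbT.
  have := part_big st; have := thr_h; lia.
have ub a : (thr < #|degge G L a|)%N -> (a <= k)%N.
  move=> big; rewrite leqNgt; apply/negP => /ltnW/(degge_leq L) ka.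
  by move: (leq_trans big (leq_trans ka small)); rewrite ltnn.
have [a big max] := ex_maxnP ex0 ub; exists a; split=> //.
  rewrite ltn_neqAle (ub a big) andbT; apply/eqP => ak.
  by move: big; rewrite ak ltnNge small.
by rewrite leqNgt; apply/negP => /max; rewrite ltnn.
Qed.

Lemma degge_inner (L : {set V}) a : (0 < #|degge G L a|)%N ->
  exists2 c, c \in L & (a <= #|L :&: nbr G c|)%N.
Proof. by case/card_gt0P => c; rewrite inE => /andP[]; exists c. Qed.

Lemma part_sum_low (L : {set V}) :
  (8 * k.+1)%:R * (#|L|%:R - \sum_(w in L) x w) <= #|L|%:R.
Proof.
rewrite -[#|L|%:R]mulr1 -sum_const -sumrB mulr_sumr; apply: ler_sum => w _.
by rewrite mulrC; exact: x_near1.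
Qed.

Lemma n_ge500 : (500 <= n)%N.
Proof. by have := n_big; have := thr_h; nia. Qed.

Lemma perron_r_half : N / 2 <= r.
Proof.
have n4 : (4 <= n)%N by have := n_ge500; lia.
have := perron_r_low k0 extr n4; have := perron_r_ge1 k0 extr n4 => r1.
by have N0 : 0 <= N by []; move=> h1; nra.
Qed.

Lemma perron_r_le_n : r <= N.
Proof.
have [v xv] := perron_max extr; have -> : r = r * x v by rewrite xv mulr1.
rewrite -(perron_eigen extr).
rewrite sum_nbr; apply: (@le_trans _ _ #|nbr G v|%:R);
  last by rewrite ler_nat max_card.
by rewrite -[leRHS]mulr1 -sum_const; apply: ler_sum => u _;
  exact: perron_le1 extr u.
Qed.

Lemma part_sum_degree_le (L : {set V}) m : (\sum_(w in L) #|L :&: nbr G w| <=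
  m)%N ->
  \sum_(w in L) #|L :&: nbr G w|%:R * x w <= m%:R.
Proof.
rewrite -(ler_nat R) natr_sum; apply: le_trans; apply: ler_sum => w _.
by rewrite -[leRHS]mulr1 ler_wpM2l // (perron_le1 extr).
Qed.

Lemma degree_sum_large L a b : stable L ->
  (\sum_(w in L) #|L :&: nbr G w| <= a * #|L| + k * thr)%N ->
  (\sum_(w in ~: L) #|~: L :&: nbr G w| <= b * #|~: L| + k * thr)%N ->
  (k <= a + b)%N.
Proof.
move=> st /part_sum_degree_le dL /part_sum_degree_le dR.
rewrite leqNgt; apply/negP => abk.
have := part_sum_le L; have := part_sum_le (~: L); rewrite setCK.
have := part_sum_low L.
set X := \sum_(w in L) x w; set Y := \sum_(w in ~: L) x w.
move: dL dR; set DL := \sum_(w in L) _; set DR := \sum_(w in ~: L) _.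
rewrite !natrD !natrM; set s : R := #|L|%:R; set s' : R := #|~: L|%:R.
set t : R := k%:R * _; set K : R := k%:R; set A : R := a%:R; set B : R := b%:R.
move=> dL dR h3 h2 h1.
have X0 : 0 <= X by apply: sumr_ge0 => w _; exact: perron_ge0 extr w.
have rN := perron_r_half; have rN' := perron_r_le_n;
  have low := perron_low extr.
have tN : 500 * t <= N.
  have : (500 * (k * thr) <= n)%N.
    by apply: leq_trans h_small; rewrite leq_mul2l leq_mul2r leqnSn !orbT.
  by rewrite -(ler_nat R) !natrM.
have KH : 1000 * (K * h%:R) <= N.
  have : (1000 * (k * h) <= n)%N.
    apply: leq_trans n_big; have := thr_h.
    have : (k * h <= k.+1 * h)%N by rewrite leq_mul2r leqnSn orbT.
    by clear; lia.
  by rewrite -(ler_nat R) !natrM.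
have [_ _ sH s'H] := st.
apply: (@degree_sum_arith R A B K N h%:R r s s' t X Y DL DR) => //.
- by rewrite ler1n.
- by rewrite -natrD natr1 ler_nat.
- by rewrite ler_nat n_ge500.
- by rewrite /t !mulr_ge0.
- by rewrite -natrD cardsC.
- by rewrite -natrM -natrD ler_nat.
- by rewrite -natrM -natrD ler_nat.
by rewrite /K natr1; exact: h3.
Qed.

(** Two matchings give (r - 1)^2 <= s s' <= N^2 / 4, that is r^2 - 2 r <= N^2 / 4 - 1, below the
    sharper bound available for even k. *)
Lemma matching_pair_contra L : stable L -> k = 2%N ->
  N ^+ 2 / 4 - 1 / 4 <= r ^+ 2 - k%:R * r ->
  {in L, forall w, #|L :&: nbr G w| <= 1}%N ->
  {in ~: L, forall w, #|~: L :&: nbr G w| <= 1}%N -> False.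
Proof.
move=> st k2 low dL dR.
have le1 (X : {set V}) : {in X, forall w, #|X :&: nbr G w| <= 1}%N ->
    \sum_(w in X) #|X :&: nbr G w|%:R * x w <= \sum_(w in X) x w.
  move=> dX; apply: ler_sum => w wX; rewrite -[leRHS]mul1r.
  by rewrite ler_wpM2r ?(perron_ge0 extr) // lern1 dX.
have := part_sum_le L; have := part_sum_le (~: L); rewrite setCK.
have := le1 _ dL; have := le1 _ dR; rewrite {}k2 in low.
have : (0 < #|L|)%N by have := part_big st; have := thr_h; lia.
case/card_gt0P => w wL.
set X := \sum_(w in L) x w; set Y := \sum_(w in ~: L) x w.
have X0 : 0 < X.
  rewrite /X (bigD1 w) //= ltr_pwDl ?entry_gt0 // sumr_ge0 // => u _.
  exact: perron_ge0 extr u.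
set DL := \sum_(w in L) _; set DR := \sum_(w in ~: L) _.
set s : R := #|L|%:R; set s' : R := #|~: L|%:R => d1 d2 h1 h2.
have sN : s + s' = N by rewrite -natrD cardsC.
have rN := perron_r_half; have N500 : 500 <= N by rewrite ler_nat n_ge500.
have m1 : (r - 1) * ((r - 1) * X) <= (r - 1) * (s * Y).
  by rewrite ler_wpM2l; lra.
have m2 : s * ((r - 1) * Y) <= s * (s' * X) by rewrite ler_wpM2l //; lra.
have m3 : (r - 1) ^+ 2 * X <= s * s' * X by lra.
rewrite ler_pM2r // in m3.
by move: low; rewrite -sN; have := sqr_ge0 (s - s'); lra.
Qed.

Lemma dense_part_exists L : stable L ->
  (~~ odd k -> N ^+ 2 / 4 - 1 / 4 <= r ^+ 2 - k%:R * r) ->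
  (thr < #|degge G L k|)%N \/ (thr < #|degge G (~: L) k|)%N.
Proof.
move=> st low; have stC := stableC st.
have [|smL] := ltnP thr #|degge G L k|; first by left.
have [|smR] := ltnP thr #|degge G (~: L) k|; first by right.
have [a [ak aL aL']] := top_degree st smL.
have [b [bk bR bR']] := top_degree stC smR.
have abk := degree_sum_large st (sum_inner_degree st aL') (sum_inner_degree
  stC bR').
have tradeL c : c \in L ->
    (#|L :&: nbr G c| + #|L :&: nbr G c|.+1 * (minn b 2).+1 <= 2 * k + 1)%N.
  move=> cL; apply: (degree_trade st cL) => //; first exact: geq_minr.
  by apply: leq_trans bR _; apply: degge_leq; exact: geq_minl.
have tradeR c : c \in ~: L ->
    (#|~: L :&: nbr G c| + #|~: L :&: nbr G c|.+1 * (minn a 2).+1 <= 2 * k +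
      1)%N.
  move=> cR; apply: (degree_trade stC cR) => //; first exact: geq_minr.
  by rewrite setCK; apply: leq_trans aL _; apply: degge_leq; exact: geq_minl.
have [c cL ac] := degge_inner (leq_ltn_trans (leq0n _) aL).
have [c' cR bc] := degge_inner (leq_ltn_trans (leq0n _) bR).
have tL := tradeL c cL; have tR := tradeR c' cR.
(* If a, b >= 2, the trades 4 a + 3 and 4 b + 3 <= 2 k + 1 contradict a + b >= k. If b = 1, then a =
   k - 1 and 3 a + 2 <= 2 k + 1 leave only k = 2; the case a = 1 is symmetric. *)
have [k2 a1 b1] : [/\ k = 2, a = 1 & b = 1]%N.
  have {}tL : (a + a.+1 * (minn b 2).+1 <= 2 * k + 1)%N.
    by apply: leq_trans tL; apply: leq_add => //;
      rewrite leq_mul2r ltnS ac orbT.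
  have {}tR : (b + b.+1 * (minn a 2).+1 <= 2 * k + 1)%N.
    by apply: leq_trans tR; apply: leq_add => //;
      rewrite leq_mul2r ltnS bc orbT.
  move: tL tR ak bk abk k0; clear => tL tR ak bk abk k0.
  have [b1|b2] : b = 1%N \/ (2 <= b)%N by lia.
    have [a1|a2] : a = 1%N \/ (2 <= a)%N by lia.
      by split; lia.
    by rewrite b1 /= in tL; lia.
  have [a1|a2] : a = 1%N \/ (2 <= a)%N by lia.
    by rewrite a1 /= in tR; lia.
  by rewrite (minn_idPr a2) in tR; rewrite (minn_idPr b2) in tL; lia.
case: (@matching_pair_contra L st k2).
- by apply: low; rewrite k2.
- by move=> w /tradeL; rewrite b1 k2; lia.
- by move=> w /tradeR; rewrite a1 k2; lia.
Qed.

End Structure.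

(** * The complete join *)

Lemma size_lower_bound (R : realType) (V : finType) k (r : R) s :
  (0 < k)%N -> fan_free_bound V k r -> 0 < r ->
  (k < s)%N -> (s <= #|V|)%N -> ~~ odd (k * s) ->
  s%:R * (#|V| - s)%:R <= r ^+ 2 - k%:R * r.
Proof.
move=> k0 bound r0 ks sn eks.
have [p [up szp _]] := @uniq_list_of_card V [set: V] s
  (leq_trans sn (eq_leq (esym (cardsT V)))).
have cL : #|[set v in p]| = s by rewrite cardsE (card_uniqP up).
have := regular_lower_bound bound k0 r0 (L := [set v in p]).
by rewrite cL => /(_ ks eks); rewrite card_setC_real cL natrB.
Qed.

(** With the sum fixed, a larger product means a more balanced pair. *)
Lemma product_centered (s s' t t' : nat) : (s + s' = t + t')%N -> (t <= t')%N ->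
  (t * t' <= s * s')%N -> (t <= s <= t')%N.
Proof.
move=> e tt' h; apply/andP; split; rewrite leqNgt; apply/negP => lt; nia.
Qed.

Lemma product_le_center (s s' t t' : nat) : (s + s' = t + t')%N ->
  (t <= t' <= t.+1)%N -> (s * s' <= t * t')%N.
Proof.
move=> e /andP[tt' t't]; rewrite leqNgt; apply/negP => lt.
have /andP[ts st] := product_centered e tt' (ltnW lt); nia.
Qed.

(** Completing the square: r - k / 2 >= m + 3 / 8, while (r - k / 2)^2 < m^2 + k^2 / 4 <= m^2 + m /
    4. *)
Lemma near_regular_arith (R : realFieldType) (r k m : R) :
  m + (k - 1 - 1 / 8) <= r -> r ^+ 2 - k * r < m * m -> 3 <= k ->
  k ^+ 2 <= m -> False.
Proof.
move=> rm lt k3 km.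
have h1 : m + 3 / 8 <= r - k / 2 by lra.
have m0 : 0 <= m by nra.
have h2 : (m + 3 / 8) ^+ 2 <= (r - k / 2) ^+ 2 by rewrite ler_pXn2r ?nnegrE
  //; lra.
by lra.
Qed.

(** The last two bounds give r <= m, hence r = m, and then the lower bound reads m^2 - 1 <= m^2 -
    m. *)
Lemma near_matching_arith (R : realFieldType) (r m : R) :
  2 * m / 2 <= r -> 1 < r -> (2 * m) ^+ 2 / 4 - 1 <= r ^+ 2 - 1 * r -> 3 <= m ->
  r ^+ 2 - 1 * r <= m * m - 1 -> m * m * r - m <= r ^+ 2 * (r - 1) -> False.
Proof.
move=> rm r1 low m3 e1 e2.
have h1 : r * (r ^+ 2 - 1 * r) <= r * (m * m - 1) by rewrite ler_wpM2l //; lra.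
have h2 : r <= m by lra.
have h3 : r = m by lra.
by rewrite h3 in low; lra.
Qed.

Section CompleteJoin.

Variables (R : realType) (V : finType) (k : nat) (G : sgraph V).
Variables (r : R) (x : V -> R) (L : {set V}).
Hypotheses (k0 : (0 < k)%N) (extr : perron_extremal k G r x).
Hypothesis GL : forall u v, G u v = bip_join L G u v.
Hypothesis dL : {in L, forall v, #|L :&: nbr G v| <= k}%N.
Hypothesis x_near1 : forall w, (1 - x w) * (8 * k.+1)%:R <= 1.
Hypothesis n_big : (500 * (k.+1 * k.+1) <= #|V|)%N.
Hypothesis LC0 : (0 < #|~: L|)%N.

Local Notation n := #|V|.
Local Notation N := (#|V|%:R : R).
Local Notation s := #|L|.
Local Notation s' := #|~: L|.
Local Notation gap := (r ^+ 2 - k%:R * r).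

Lemma entry_low w : 15 / 16 <= x w.
Proof.
have := x_near1 w; have : 16 <= (8 * k.+1)%:R :> R by rewrite ler_nat; lia.
by have := perron_le1 extr w; nra.
Qed.

Lemma r_half : N / 2 <= r.
Proof.
have n4 : (4 <= n)%N by nia.
have := perron_r_low k0 extr n4; have := perron_r_ge1 k0 extr n4 => r1.
by have N0 : 0 <= N by []; move=> h1; nra.
Qed.

Lemma r_gt1 : 1 < r.
Proof.
have := r_half; have : 4 <= N by rewrite ler_nat; nia.
by lra.
Qed.

Lemma size_bound t : (k < t)%N -> (t <= n)%N -> ~~ odd (k * t) ->
  t%:R * (n - t)%:R <= gap.
Proof.
by apply: size_lower_bound k0 (perron_bound extr) _; have := r_gt1; lra.
Qed.

Lemma sum_L_opposite v : v \in ~: L -> r * x v = \sum_(w in L) x w.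
Proof.
rewrite inE -(perron_eigen extr) => vL.
by rewrite (eq_bigl _ _ (GL v)) sum_bip_join (negbTE vL).
Qed.

Lemma opposite_const u v : u \in ~: L -> v \in ~: L -> x u = x v.
Proof.
move=> /sum_L_opposite eu /sum_L_opposite ev.
have r0 : r != 0 by rewrite gt_eqF //; have := r_gt1; lra.
by apply: (mulfI r0); rewrite eu ev.
Qed.

Lemma eigen_inner v z : v \in L -> z \in ~: L ->
  r * x v = s'%:R * x z + \sum_(u in L | G v u) x u.
Proof.
move=> vL zR; rewrite -(perron_eigen extr) (eq_bigl _ _ (GL v)) sum_bip_join vL.
by congr (_ + _); rewrite -sum_const; apply: eq_bigr => u /opposite_const;
  exact.
Qed.

(* The defect of [r] from the root of the regular case is carried by the
   vertices of [L] of inner degree less than [k]. *)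
Lemma deficiency_identity z : z \in ~: L ->
  (gap - s%:R * s'%:R) * x z = - \sum_(v in L) (k - #|L :&: nbr G v|)%:R * x v.
Proof.
move=> zR.
have e1 : r * (\sum_(v in L) x v) =
    s%:R * (s'%:R * x z) + \sum_(v in L) #|L :&: nbr G v|%:R * x v.
  rewrite mulr_sumr (eq_bigr _ (fun v vL => eigen_inner vL zR)) big_split /=.
  rewrite sum_const; congr (_ + _).
  rewrite (exchange_big_dep (mem L)) /=; last by move=> u w _ /andP[].
  apply: eq_bigr => u uL; rewrite -sum_const; apply: eq_bigl => w.
  by rewrite in_setI in_nbr uL adj_sym.
have e2 : \sum_(v in L) (k - #|L :&: nbr G v|)%:R * x v =
    k%:R * (\sum_(v in L) x v) - \sum_(v in L) #|L :&: nbr G v|%:R * x v.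
  rewrite mulr_sumr -sumrB; apply: eq_bigr => v vL.
  by rewrite natrB ?dL // mulrBl.
by rewrite e2; move: e1; rewrite -(sum_L_opposite zR); lra.
Qed.

Lemma card_LR : (s + s' = n)%N. Proof. exact: cardsC. Qed.

(** Entries are at least 15 / 16, so a deficiency of 2 would make the right side of the identity
    less than -1, whereas gap - s s' >= -1 and x_z <= 1. *)
Lemma deficiency_le1 : (\sum_(v in L) (k - #|L :&: nbr G v|) <= 1)%N.
Proof.
rewrite leqNgt; apply/negP => D2; have [z zR] := card_gt0P LC0.
have := deficiency_identity zR; have low := perron_low extr.
have : 2 * (15 / 16) <= \sum_(v in L) (k - #|L :&: nbr G v|)%:R * x v.
  apply: (@le_trans _ _ ((\sum_(v in L) (k - #|L :&: nbr G v|))%:R * (15 /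
    16))).
    by rewrite ler_pM2r ?ler_nat //; lra.
  rewrite natr_sum mulr_suml; apply: ler_sum => v _.
  by rewrite ler_wpM2l // entry_low.
set S := \sum_(v in L) _ => h1 h2.
have sN : s%:R + s'%:R = N :> R by rewrite -natrD card_LR.
have z1 := perron_le1 extr z; have z0 := entry_low z.
have : -1 <= gap - s%:R * s'%:R.
  by move: low; rewrite -sN; have := sqr_ge0 (s%:R - s'%:R : R); lra.
set g := gap - _ in h2 * => g1; have : - x z <= g * x z.
  by rewrite -mulN1r ler_wpM2r //; lra.
by lra.
Qed.

Lemma deficiency_cases :
  {in L, forall v, #|L :&: nbr G v| = k} \/
  exists2 v0, v0 \in L & #|L :&: nbr G v0| = k.-1 /\
    {in L, forall v, v != v0 -> #|L :&: nbr G v| = k}.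
Proof.
have := deficiency_le1.
have [/forall_inP full _|] := boolP [forall v in L, #|L :&: nbr G v| == k].
  by left=> v vL; apply/eqP/full.
rewrite negb_forall_in => /exists_inP[v0 v0L d0] D1; right; exists v0 => //.
have d0k := dL v0L;
  have {}d0 : (#|L :&: nbr G v0| < k)%N by rewrite ltn_neqAle d0.
rewrite (bigD1 v0) //= in D1; split; first lia.
move=> v vL vv0; have dvk := dL vL.
rewrite (bigD1 v) /= ?vL // in D1.
by lia.
Qed.

Lemma regular_gap : {in L, forall v, #|L :&: nbr G v| = k} ->
  gap = s%:R * s'%:R /\ ~~ odd (k * s).
Proof.
move=> full; split.
  have [z zR] := card_gt0P LC0; have := deficiency_identity zR.
  rewrite big1 => [/eqP|v vL]; last by rewrite full // subnn mul0r.
  rewrite oppr0 mulf_eq0 subr_eq0 => /orP[/eqP //|].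
  by have z0 := entry_low z; rewrite gt_eqF //; lra.
have := even_sum_inner_degree G L.
by rewrite (eq_bigr _ full) sum_nat_const mulnC.
Qed.

(** The inner degree sum k |L| - 1 is even, so k and |L| are odd; the identity has a single term
    left. *)
Lemma near_regular_gap v0 : v0 \in L -> #|L :&: nbr G v0| = k.-1 ->
  {in L, forall v, v != v0 -> #|L :&: nbr G v| = k} ->
  (forall z, z \in ~: L -> (gap - s%:R * s'%:R) * x z = - x v0) /\
  (odd k /\ odd s).
Proof.
move=> v0L d0 dv; split=> [z zR|].
  rewrite deficiency_identity // (bigD1 v0) //= d0 big1 => [|v /andP[vL vv0]].
    by rewrite addr0 -subn1 subKn // mul1r.
  by rewrite dv // subnn mul0r.
have := even_sum_inner_degree G L; rewrite (bigD1 v0) //= d0.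
rewrite (eq_bigr (fun=> k)); last by move=> v /andP[vL vv0]; exact: dv.
rewrite sum_nat_const.
have -> : #|[pred v in L | v != v0]| = s.-1.
  by rewrite (cardsD1 v0 L) v0L /=; apply: eq_card => v; rewrite !inE andbC.
have : (0 < s)%N by apply/card_gt0P; exists v0.
case: (s) => // m _ /=; rewrite oddD oddM negb_add.
by case: (k) k0 => // k' _ /=; case: (odd k'); case: (odd m).
Qed.


Lemma size_bound_nat t : (k < t)%N -> (t <= n)%N -> ~~ odd (k * t) ->
  gap <= s%:R * s'%:R -> (t * (n - t) <= s * s')%N.
Proof.
by move=> kt tn ekt h; rewrite -(ler_nat R) !natrM (le_trans _ h) // size_bound.
Qed.

Lemma size_bound_nat_lt t : (k < t)%N -> (t <= n)%N -> ~~ odd (k * t) ->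
  gap < s%:R * s'%:R -> (t * (n - t) < s * s')%N.
Proof.
by move=> kt tn ekt h;
  rewrite -(ltr_nat R) !natrM (le_lt_trans _ h) // size_bound.
Qed.

Lemma near_regular_gap_lt v0 : v0 \in L ->
  (forall z, z \in ~: L -> (gap - s%:R * s'%:R) * x z = - x v0) ->
  gap < s%:R * s'%:R.
Proof.
move=> v0L eq0; have [z zR] := card_gt0P LC0; have := eq0 z zR.
have := entry_low z; have := entry_low v0; rewrite -subr_lt0.
by set g := gap - _ => h1 h2 h3; nra.
Qed.

(* For [k >= 3] the vertex of inner degree [k - 1] has a larger entry than the
   vertices of the opposite part, so the defect is more than [1]. *)
Lemma near_regular_balanced_contra v0 m : (3 <= k)%N -> n = m.*2 -> s = m ->
  v0 \in L -> #|L :&: nbr G v0| = k.-1 ->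
  (forall z, z \in ~: L -> (gap - s%:R * s'%:R) * x z = - x v0) ->
  m%:R ^+ 2 - 1 <= gap -> False.
Proof.
move=> k3 nm sm v0L d0 eq0 low; have [z zR] := card_gt0P LC0.
have s'm : s' = m by have := card_LR; lia.
have := eq0 z zR; rewrite s'm sm => e0.
have lt := near_regular_gap_lt v0L eq0; rewrite s'm sm in lt.
have z0 := entry_low z; have z1 := perron_le1 extr z.
have w0 := entry_low v0.
(* The lower bound on the gap keeps the factor of x_z at or above -1. *)
have zv : x v0 <= x z.
  rewrite leNgt; apply/negP => zv.
  have : (gap - m%:R * m%:R) * x z < - x z by lra.
  by rewrite -[- x z]mulN1r ltr_pM2r; lra.
have := eigen_inner v0L zR; rewrite s'm.
have sumv : (1 - 1 / (8 * k.+1)%:R) * k.-1%:R <= \sum_(u in L | G v0 u) x u.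
  rewrite -d0 mulrC -sum_const.
  rewrite (eq_bigl (fun u => (u \in L) && G v0 u)); last first.
    by move=> u; rewrite in_setI in_nbr.
  apply: ler_sum => u _; have := x_near1 u.
  have K0 : 0 < (8 * k.+1)%:R :> R by rewrite ltr0n.
  by rewrite -ler_pdivlMr //; set c := _ / _; lra.
set S := \sum_(u in L | _) _ in sumv * => e1.
have N1 : k%:R ^+ 2 <= m%:R :> R.
  have : (k * k <= m)%N by move: n_big; rewrite nm -mul2n; clear; nia.
  by rewrite -(ler_nat R) natrM expr2.
have K3 : 3 <= k%:R :> R by rewrite (ler_nat R 3).
have kk : k.-1%:R = k%:R - 1 :> R by rewrite -subn1 natrB.
have SS : k%:R - 1 - 1 / 8 <= S.
  have ME : (8 * k.+1)%:R = 8 * (k%:R + 1) :> R by rewrite natrM natr1.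
  apply: le_trans sumv; rewrite kk ME.
  have : (k%:R - 1) * (1 / (8 * (k%:R + 1))) <= 1 / 8 :> R.
    by rewrite mulrA mulr1 ler_pdivrMr; lra.
  by lra.
have r1 := r_gt1.
(* The k - 1 inner neighbours of [v0] add nearly k - 1 to r x_v0, which is at most r x_z. *)
have rm : m%:R + (k%:R - 1 - 1 / 8) <= r.
  have : r * x v0 <= r * x z by rewrite ler_wpM2l //; lra.
  rewrite e1 => h.
  have SZ : (k%:R - 1 - 1 / 8) * x z <= S.
    by apply: le_trans SS; rewrite ler_piMr //; lra.
  have : (m%:R + (k%:R - 1 - 1 / 8)) * x z <= r * x z by lra.
  by rewrite ler_pM2r; lra.
exact: near_regular_arith rm lt K3 N1.
Qed.

(** An unbalanced regular graph has gap at most m^2 - 1, and is beaten by the near-perfect matching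
    in a part of odd size m. *)
Lemma regular_odd_contra m : k = 1%N -> n = m.*2 -> odd m ->
  gap = s%:R * s'%:R -> (s * s' < m * m)%N -> False.
Proof.
move=> k1 nm om e lt.
have m3 : (2 < m)%N by nia.
have mn : (m <= #|[set: V]|)%N by rewrite cardsT nm -addnn leq_addr.
have [p [up szp _]] := uniq_list_of_card mn.
have cM : #|[set v in p]| = m by rewrite cardsE (card_uniqP up).
have cM' : #|~: [set v in p]| = m by rewrite cardsCs setCK cM nm; lia.
have := near_matching_lower_bound (perron_bound extr) k0 (L :=
  [set v in p]) k1 r_gt1.
rewrite cM cM' => /(_ om m3 (ltn_trans (ltn0Sn _) m3)).
have rN := r_half; have r1 := r_gt1.
have : gap <= m%:R * m%:R - 1.
  by rewrite e -!natrM lerBrDr natr1 ler_nat.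
rewrite k1 nm -mul2n natrM in rN *.
have low := perron_low extr; rewrite k1 nm -mul2n natrM in low.
have M3 : 3 <= m%:R :> R by rewrite (ler_nat R 3).
by move=> h1 h2; apply: near_matching_arith rN r1 low M3 h1 h2.
Qed.

(** For even k the near-regular case is impossible, and blocks fit a part of any admissible size, so
    the balanced partition must not beat s s'. *)
Lemma part_size_even : ~~ odd k -> s = (n %/ 2)%N \/ s = ((n + 1) %/ 2)%N.
Proof.
move=> ek; have sL := card_LR.
have nk : (500 * k.+1 <= n)%N by apply: leq_trans n_big;
  rewrite leq_mul2l leq_pmull.
have [full|[v0 v0L [d0 dv]]] := deficiency_cases; last first.
  have [_ [ok _]] := near_regular_gap v0L d0 dv.
  by rewrite ok in ek.
have [e _] := regular_gap full.
have h : (n %/ 2 * (n - n %/ 2) <= s * s')%N.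
  by apply: size_bound_nat; rewrite ?e ?oddM ?(negbTE ek) //; lia.
have := product_centered _ _ h; lia.
Qed.

(** In the regular case |L| is even, and comparison with the even size nearest n / 2 fixes it. In
    the near-regular case |L| is odd and the gap is strictly below s s', so an even central size is
    excluded; this leaves only n = 2 modulo 4 with k = 1. *)
Lemma part_size_odd : odd k ->
  [/\ (n %% 4 = 0)%N -> s = (n %/ 2)%N,
      (n %% 4 = 1)%N -> s = ((n - 1) %/ 2)%N,
      (k = 1)%N -> (n %% 4 = 2)%N -> s = (n %/ 2)%N,
      (3 <= k)%N -> (n %% 4 = 2)%N -> s = (n %/ 2 - 1)%N \/ s = (n %/ 2 + 1)%N &
      (n %% 4 = 3)%N -> s = ((n + 1) %/ 2)%N].
Proof.
move=> ok; have sL := card_LR.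
have nk : (500 * k.+1 <= n)%N by apply: leq_trans n_big;
  rewrite leq_mul2l leq_pmull.
have bound t : (k < t)%N -> (t <= n)%N -> ~~ odd t -> gap <= s%:R * s'%:R ->
    (t * (n - t) <= s * s')%N.
  by move=> kt tn et; apply: size_bound_nat; rewrite // oddM (negbTE et) andbF.
have bound_lt t : (k < t)%N -> (t <= n)%N -> ~~ odd t -> gap < s%:R * s'%:R ->
    (t * (n - t) < s * s')%N.
  by move=> kt tn et; apply: size_bound_nat_lt;
    rewrite // oddM (negbTE et) andbF.
have [full|[v0 v0L [d0 dv]]] := deficiency_cases.
  have [e eks] := regular_gap full.
  have es : ~~ odd s by move: eks; rewrite oddM ok.
  have {}bound t : (k < t)%N -> (t <= n)%N -> ~~ odd t -> (t * (n - t) <= s *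
    s')%N.
    by move=> kt tn et; apply: bound; rewrite ?e.
  split=> [n4|n4|k1 n4|k3 n4|n4].
  - have h : (n %/ 2 * (n - n %/ 2) <= s * s')%N by apply: bound; lia.
    by have := product_centered _ _ h; lia.
  - have h : ((n - 1) %/ 2 * (n - (n - 1) %/ 2) <= s * s')%N by apply: bound;
    lia.
    by have := product_centered _ _ h; lia.
  (* Here n / 2 is odd while s is even, so s s' is strictly below the square of n / 2. *)
  - case: (@regular_odd_contra (n %/ 2)) => //; [lia|lia|].
    have le : (s * s' <= n %/ 2 * (n %/ 2))%N by apply: product_le_center; lia.
    rewrite ltn_neqAle le andbT; apply/eqP => eq.
    have h : (n %/ 2 * (n %/ 2) <= s * s')%N by rewrite eq.
    by have := product_centered _ _ h; lia.
  - have h : ((n %/ 2 - 1) * (n %/ 2 + 1) <= s * s')%N.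
      have := @bound (n %/ 2 - 1)%N;
        have -> : (n - (n %/ 2 - 1) = n %/ 2 + 1)%N by lia.
      by apply; lia.
    by have := product_centered _ _ h; lia.
  - have h : ((n + 1) %/ 2 * (n - (n + 1) %/ 2) <= s * s')%N by apply: bound;
    lia.
    by move: h; rewrite mulnC => h; have := product_centered _ _ h; lia.
have [eq0 [_ os]] := near_regular_gap v0L d0 dv.
have lt := near_regular_gap_lt v0L eq0.
have {bound}bound_lt t : (k < t)%N -> (t <= n)%N -> ~~ odd t ->
    (t * (n - t) < s * s')%N by move=> kt tn et; exact: bound_lt.
have balanced : (n %% 4 = 2)%N -> s = (n %/ 2)%N.
  move=> n4; have h : ((n %/ 2 - 1) * (n %/ 2 + 1) < s * s')%N.
    have := @bound_lt (n %/ 2 - 1)%N;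
      have -> : (n - (n %/ 2 - 1) = n %/ 2 + 1)%N by lia.
    by apply; lia.
  by have := product_centered _ _ (ltnW h); nia.
(* No product strictly exceeds that of a central pair, so an even central size contradicts the
   strict bound. *)
have center t t' : (t + t' = n)%N -> (t <= t' <= t.+1)%N ->
    (t * t' < s * s')%N -> False.
  move=> tn tt'; apply/negP; rewrite -leqNgt.
  by apply: product_le_center; rewrite ?tn.
split=> [n4|n4|_|k3 n4|n4]; last 2 first.
- case: (@near_regular_balanced_contra v0 (n %/ 2)) => //;
  [lia|exact: balanced|].
  apply: le_trans (perron_low extr); rewrite lerD2r.
  have nE : n%:R = 2 * (n %/ 2)%:R :> R by rewrite -natrM; congr _%:R; lia.
  by rewrite nE; lra.
- case: (@center (n - (n + 1) %/ 2)%N ((n + 1) %/ 2)%N); [lia|lia|].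
  by rewrite mulnC; apply: bound_lt; lia.
- by case: (@center (n %/ 2)%N (n - n %/ 2)%N); [lia|lia|apply: bound_lt; lia].
- case: (@center ((n - 1) %/ 2)%N (n - (n - 1) %/ 2)%N); [lia|lia|].
  by apply: bound_lt; lia.
- exact: balanced.
Qed.

End CompleteJoin.

(** * The extremal graphs *)

Lemma nat_gap_low (R : realFieldType) (n t d : nat) (g : R) : (t <= n)%N ->
  (n * n <= 4 * (t * (n - t)) + d)%N -> t%:R * (n - t)%:R <= g ->
  n%:R ^+ 2 / 4 - d%:R / 4 <= g.
Proof.
move=> tn; rewrite -(ler_nat R) natrD !natrM => h1 h2; rewrite expr2; lra.
Qed.

Lemma gap_low_even (R : realType) (V : finType) k (r : R) :
  (0 < k)%N -> fan_free_bound V k r -> 0 < r -> (2 * k.+1 <= #|V|)%N ->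
  ~~ odd k -> #|V|%:R ^+ 2 / 4 - 1 / 4 <= r ^+ 2 - k%:R * r.
Proof.
move=> k0 bound r0 nk ek.
have tn : (#|V|./2 <= #|V|)%N by lia.
apply: (@nat_gap_low R _ _ 1 _ tn).
  by have := odd_double_half #|V|; case: (odd _); nia.
by apply: size_lower_bound => //; [lia | rewrite oddM (negbTE ek)].
Qed.

Lemma gap_low (R : realType) (V : finType) k (r : R) :
  (0 < k)%N -> fan_free_bound V k r -> 0 < r -> (2 * k.+1 <= #|V|)%N ->
  #|V|%:R ^+ 2 / 4 - 1 <= r ^+ 2 - k%:R * r.
Proof.
move=> k0 bound r0 nk.
(* Half of n rounded up to an even t: then k t is even for every k, and (n - 2 t)^2 <= 4. *)
have tn : (#|V|./2 + odd #|V|./2 <= #|V|)%N by case: (odd _./2); lia.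
suff : #|V|%:R ^+ 2 / 4 - 4%:R / 4 <= r ^+ 2 - k%:R * r by lra.
apply: (@nat_gap_low R _ _ 4 _ tn).
  by have := odd_double_half #|V|; case: (odd #|V|); case: (odd _./2); nia.
by apply: size_lower_bound => //; [lia | rewrite oddM oddD oddb addbb andbF].
Qed.

(** The nonnegative eigenvector is divided by its largest entry; optimality passes to quadratic
    forms through the spectral radius of each competitor. *)
Lemma SPEX_perron_extremal (R : realType) (n k : nat) (G : sgraph 'I_n) :
  (0 < k)%N -> (2 * k.+1 <= n)%N -> SPEX R (fan (2 * k + 2)) G ->
  exists (r : R) (x : 'I_n -> R), perron_extremal k G r x.
Proof.
move=> k0 nk [Gfree [r [[rG rmax] opt]]].
have n0 : (0 < n)%N by lia.
have [mu [x [[muG mumax] x0 [v xv] ex ub]]] := @spectral_radius_exists R n G n0.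
have rmu : r = mu by apply/le_anti; rewrite rmax // mumax.
have bound : fan_free_bound 'I_n k r.
  move=> H Hfree y;
    have [nu [_ [nuH _ _ _ nub]]] := @spectral_radius_exists R n H n0.
  apply: le_trans (nub y) _; rewrite ler_wpM2r ?(opt H nu) //.
  by apply: sumr_ge0 => u _; exact: sqr_ge0.
have r0 : 0 < r by apply: (fan_free_bound_gt0 bound k0); rewrite card_ord; lia.
pose w := [arg max_(u > v) x u]%O.
have wmax u : x u <= x w by rewrite /w; case: arg_maxP => // i _; apply.
have w0 : 0 < x w := lt_le_trans xv (wmax v).
exists r, (fun u => x u / x w); split=> //.
- by move=> u; rewrite divr_ge0 // ltW.
- by move=> u; rewrite ler_pdivrMr // mul1r.
- by exists w; rewrite divff ?gt_eqF.
- by move=> u; rewrite -mulr_suml ex rmu mulrA.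
- by apply: gap_low => //; rewrite card_ord.
Qed.

(** * The embedded graph as an induced subgraph *)

Section InducedSubgraph.

Variables (V : finType) (G : sgraph V) (L : {set V}).

Definition induced_rel : rel {u : V | u \in L} := fun u v => G (val u) (val v).

Lemma induced_sym : symmetric induced_rel.
Proof. by move=> u v; rewrite /induced_rel adj_sym. Qed.

Lemma induced_irr : irreflexive induced_rel.
Proof. by move=> u; rewrite /induced_rel adj_irr. Qed.

Definition induced : sgraph {u : V | u \in L} := SGraph induced_sym induced_irr.

Lemma degree_induced u : degree induced u = #|L :&: nbr G (val u)|.
Proof.
rewrite /degree -(card_imset _ val_inj); apply: eq_card => v.
apply/imsetP/setIP => [[w]|[vL uv]]; rewrite ?inE.
  by move=> uw ->; split; [exact: valP | exact: uw].
by exists (Sub v vL); rewrite ?SubK // inE /= /induced_rel SubK -in_nbr.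
Qed.

Lemma embed_induced : (forall u v, G u v = bip_join L G u v) ->
  adj G =2 adj (embed (complete_bipartite L) induced).
Proof.
move=> GL u v; rewrite GL /= /bip_join_rel /embed_rel /=; congr (_ || _).
apply/and3P/existsP => [[uL vL uv]|[a /existsP[b /and3P[/eqP <- /eqP <- ab]]]].
  exists (Sub u uL); apply/existsP; exists (Sub v vL).
  by rewrite !SubK !eqxx /= /induced_rel !SubK.
by split=> //; exact: valP.
Qed.

Lemma induced_path_free l :
  (forall p, uniq p -> sorted G p -> {subset p <= L} -> size p = l -> False) ->
  ~ contains_subgraph induced (path_graph l).
Proof.
move=> noP /contains_pathP[p [up sp szp]].
apply: (noP (map val p)); rewrite ?map_inj_uniq ?size_map ?sorted_map //.
  exact: val_inj.
by move=> _ /mapP[u _ ->]; exact: valP.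
Qed.

End InducedSubgraph.

Lemma extremal_structure (k : nat) : (0 < k)%N ->
  exists n0 : nat, forall (R : realType) (V : finType) (G : sgraph V) (r : R)
    (x : V -> R), perron_extremal k G r x ->
    (~~ odd k -> #|V|%:R ^+ 2 / 4 - 1 / 4 <= r ^+ 2 - k%:R * r) ->
    (n0 <= #|V|)%N ->
  exists L : {set V},
    [/\ forall u v, G u v = bip_join L G u v,
        {in L, forall v, #|L :&: nbr G v| <= k}%N,
        forall p, uniq p -> sorted G p -> {subset p <= L} ->
          size p = (2 * k + 2)%N -> False,
        forall w, (1 - x w) * (8 * k.+1)%:R <= 1 &
        (500 * (k.+1 * k.+1) <= #|V|)%N /\ (0 < #|~: L|)%N].
Proof.
(* Makes 500 (k + 1) times the threshold 2 (k + 1)^2 h equal to M h, which stability keeps at most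
   n. *)
move=> k0; pose M := (1000 * (k.+1 * (k.+1 * k.+1)))%N.
have M0 : (0 < M)%N by rewrite !muln_gt0.
have [n0 st] := stability k0 M0; exists n0 => R V G r x extr even_low nV.
have [L [h [[Mn Mh] L1 L2 [L3 L4] near]]] := st R V G r x extr nV.
have KM : (k.+1 <= k.+1 * (k.+1 * k.+1))%N by rewrite leq_pmulr.
have h_big : (10 * k.+1 <= h)%N by apply: leq_trans Mh; rewrite leq_mul.
have h_small : (500 * (k.+1 * (2 * (k.+1 * (k.+1 * h)))) <= #|V|)%N.
  by apply: leq_trans Mn; apply: eq_leq; rewrite /M; ring.
have near8 w : (1 - x w) * (8 * k.+1)%:R <= 1.
  apply: le_trans (near w); rewrite ler_wpM2l ?subr_ge0 ?(perron_le1 extr) //.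
  by rewrite ler_nat leq_mul.
have n_big : (500 * (k.+1 * k.+1) <= #|V|)%N.
  apply: leq_trans h_small; rewrite leq_mul2l leq_mul2l /=.
  apply: leq_trans (_ : k.+1 * h <= _)%N; first by rewrite leq_pmulr //; lia.
  by apply: leq_trans (leq_pmull _ (ltn0Sn 1)); rewrite leq_pmull.
have stL : stable G h L by [].
(* Either side of the stable partition may be the dense one, so the conclusion is prepared for
   both. *)
have finish X : stable G h X -> (2 * (k.+1 * (k.+1 * h)) < #|degge G X k|)%N ->
    exists L : {set V},
    [/\ forall u v, G u v = bip_join L G u v,
        {in L, forall v, #|L :&: nbr G v| <= k}%N,
        forall p, uniq p -> sorted G p -> {subset p <= L} ->
          size p = (2 * k + 2)%N -> False,
        forall w, (1 - x w) * (8 * k.+1)%:R <= 1 &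
        (500 * (k.+1 * k.+1) <= #|V|)%N /\ (0 < #|~: L|)%N].
  move=> stX big; exists X; split=> //.
  - exact: (complete_join k0 extr h_big h_small near8 stX big).
  - exact: (inner_degree k0 extr h_big h_small stX).
  - move=> p; exact: (part_path_free k0 extr h_big h_small stX).
  - split=> //; have := part_big k0 h_big h_small (stableC stX).
    by apply: leq_trans; rewrite !muln_gt0 /=; lia.
have [big|big] := dense_part_exists k0 extr h_big h_small near8 stL even_low.
  exact: finish stL big.
exact: finish (stableC stL) big.
Qed.

Theorem theorem1p4 (R : realType) (k : nat) (hk : (1 <= k)%N) :
  exists n0 : nat, forall n : nat, (n0 <= n)%N ->
  forall G : sgraph 'I_n, SPEX R (fan (2 * k + 2)%N) G ->
  exists (L : {set 'I_n}) (Q : sgraph {x : 'I_n | x \in L}),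
    [/\ adj G =2 adj (embed (complete_bipartite L) Q),
        regular k Q \/ nearly_regular k Q,
        ~ contains_subgraph Q (path_graph (2 * k + 2)%N),
        ~~ odd k -> #|L| = (n %/ 2)%N \/ #|L| = ((n + 1) %/ 2)%N &
        odd k ->
        [/\ (n %% 4 = 0)%N -> #|L| = (n %/ 2)%N,
            (n %% 4 = 1)%N -> #|L| = ((n - 1) %/ 2)%N,
            (k = 1)%N -> (n %% 4 = 2)%N -> #|L| = (n %/ 2)%N,
            (3 <= k)%N -> (n %% 4 = 2)%N ->
              #|L| = (n %/ 2 - 1)%N \/ #|L| = (n %/ 2 + 1)%N &
            (n %% 4 = 3)%N -> #|L| = ((n + 1) %/ 2)%N]].
Proof.
have [n0 str] := extremal_structure hk.
exists (n0 + 2 * k.+1)%N => n nn G spex.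
have nk : (2 * k.+1 <= n)%N by lia.
have [r [x extr]] := SPEX_perron_extremal hk nk spex.
have bound := perron_bound extr.
have [|| L [GL dL noP near [nb LC0]]] := str R _ G r x extr;
  rewrite ?card_ord; [|lia|].
  move=> ek; have := @gap_low_even R 'I_n k r hk bound _ _ ek;
    rewrite card_ord; apply=> //.
  by apply: (fan_free_bound_gt0 bound hk); rewrite card_ord; lia.
exists L, (induced G L); split.
- exact: embed_induced.
- have [full|[v0 v0L [d0 dv]]] := deficiency_cases hk extr GL dL near nb LC0.
    by left=> u; rewrite degree_induced; apply: full; exact: valP.
  right; exists (Sub v0 v0L); split; first by rewrite degree_induced SubK.
  by move=> u uv;
    rewrite degree_induced dv ?(valP u) // -[v0](SubK _ v0L) (inj_eq val_inj).
- exact: induced_path_free.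
- have := part_size_even hk extr GL dL near nb LC0; by rewrite card_ord.
- have := part_size_odd hk extr GL dL near nb LC0; by rewrite card_ord.
Qed.
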